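(* Let $P(z)\in\mathbb{C}[z]$ be a monic polynomial of degree $N$ with $P(0)\neq 0$. Then $$\mathcal{D}(P)\le \frac{4}{\sqrt{\pi}}\,\sqrt{N\,h(P)}.$$
   Context: Write $P(z)=\prod_{j=1}^N (z-\alpha_j)=z^N+a_{N-1}z^{N-1}+\cdots+a_0$ with $N\ge 1$ and $a_0=P(0)\neq 0$, where the roots (listed with multiplicity) are $\alpha_j=\rho_j e^{2\pi i\theta_j}$, $\rho_j>0$, $\theta_j\in\mathbb{R}/\mathbb{Z}$. Let $\log^+ x=\max\{\log x,0\}$ (with $\log^+ 0=0$) and define $$h(P)=\int_0^1 \log^+\!\left(\frac{|P(e^{2\pi i\theta})|}{\sqrt{|a_0|}}\right)d\theta .$$ For an interval $I\subset\mathbb{R}/\mathbb{Z}$ of length $|I|$ (a single point is allowed as an interval), let $N(I;P)$ be the number of indices $j\in\{1,\dots,N\}$ with $\theta_j\in I$ (zeros counted with multiplicity). The discrepancy is $$\mathcal{D}(P)=\sup_I \big|N(I;P)-|I|\,N\big|,$$ the supremum being over all intervals $I\subset\mathbb{R}/\mathbb{Z}$. *)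

(* Defs.v *)
From HB Require Import structures.
From mathcomp Require Import all_boot all_order all_algebra.
From mathcomp Require Import complex.
From mathcomp Require Import all_classical all_reals all_analysis.

Set Implicit Arguments.
Unset Strict Implicit.
Unset Printing Implicit Defensive.

Import Order.TTheory GRing.Theory Num.Theory.
Import numFieldNormedType.Exports.

Local Open Scope classical_set_scope.
Local Open Scope ring_scope.
Local Open Scope complex_scope.

(* t |-> e^{2 pi i t}; it identifies R/Z with the unit circle. *)
Definition expi2pi (R : realType) (t : R) : R[i] :=
  cos (2 * pi * t) +i* sin (2 * pi * t).

(* The library's norm `|z| on R[i] takes values in R[i]; this is the same
   modulus as an element of R. *)
Definition cmod (R : realType) (z : R[i]) : R := Normc.normc z.

(* log^+ 0 = 0, because ln x = 0 for x <= 0. *)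
Definition logplus (R : realType) (x : R) : R := Num.max (ln x) 0.

Definition height (R : realType) (P : {poly R[i]}) : R :=
  \int[lebesgue_measure]_(t in `[0%R, 1%R])
    logplus (cmod P.[expi2pi t] / Num.sqrt (cmod P.[0])).

(* The roots alpha_1, ..., alpha_N, repeated according to multiplicity. *)
Definition zeros (R : realType) (P : {poly R[i]}) : seq R[i] :=
  sval (closed_field_poly_normal P).

(* For z != 0: the argument theta in R/Z of z = rho e^{2 pi i theta} lies in
   the image of J in R/Z. *)
Definition arg_in (R : realType) (J : set R) (z : R[i]) : Prop :=
  exists2 t : R, J t & z = (cmod z)%:C * expi2pi t.

Definition zero_count (R : realType) (J : set R) (P : {poly R[i]}) : nat :=
  count (fun z => `[< arg_in J z >]) (zeros P).

(* An interval of R/Z is the image of a real interval with endpoints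
   a <= b <= a + 1, and its length is b - a. The lower endpoint is included
   when ca = true, the upper one when cb = false: for example [a, a] is a
   single point, [a, a + 1[ is the whole circle and ]a, a + 1[ is the circle
   without a point. *)
Definition deviations (R : realType) (P : {poly R[i]}) : set R :=
  [set x | exists (a b : R) (ca cb : bool), a <= b <= a + 1 /\
    x = `|(zero_count [set` Interval (BSide ca a) (BSide cb b)] P)%:R
          - (b - a) * (size P).-1%:R| ].

Definition discrepancy (R : realType) (P : {poly R[i]}) : R :=
  sup (deviations P).

(* The supremum is a genuine one, not the default value of sup. *)
Lemma has_sup_deviations (R : realType) (P : {poly R[i]}) :
  has_sup (deviations P).
Proof.
split; first by exists `|(zero_count [set` Interval (BSide true 0) (BSide true 0)] P)%:R
          - (0 - 0) * (size P).-1%:R|, 0, 0, true, true; rewrite lexx add0r ler01.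
exists ((size (zeros P))%:R + (size P).-1%:R) => _ [a [b [ca [cb [/andP[ab ba] ->]]]]].
apply: (le_trans (ler_normB _ _)); apply: lerD.
  by rewrite ger0_norm ?ler0n// ler_nat count_size.
by rewrite ger0_norm ?mulr_ge0 ?ler0n ?subr_ge0// ler_piMl ?ler0n// lerBlDl.
Qed.

(* Main.v *)
Require Import Defs.
From mathcomp Require Import all_boot all_order all_algebra.
From mathcomp Require Import complex.
From mathcomp Require Import all_classical all_reals all_analysis.
From mathcomp Require Import measurable_realfun ring lra.

Set Implicit Arguments.
Unset Strict Implicit.
Unset Printing Implicit Defensive.

Import Order.TTheory GRing.Theory Num.Theory.
Import numFieldNormedType.Exports.
Local Open Scope classical_set_scope.
Local Open Scope ring_scope.

(** The proof bounds the number of zeros in an arc from above by means of the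
    logarithmic potential of the zeros and of a smoothing kernel obtained by sweeping
    a point mass onto an arc.

    Projecting the zeros radially to points [e^{2 pi i theta_j}] of the unit circle
    does not increase [|P(e^{2 pi i t})| / sqrt |P(0)|] ([sine_le_cmod]). Hence the
    potential [u(t) = sum_j ln |2 sin (pi (t - theta_j))|] is at most the integrand
    of the height. Since [u] has mean zero over a period ([Rintegral_logsin]), the
    integral of [u] over any interval of length at most [1] lies between [-h] and
    [h], where [h] is the height.

    For [eta > 0] let [delta = atan (sinh eta) / pi]. Let [t(p)] be the point of
    [[delta, 1 - delta]] with [sinh eta * cot (pi t(p)) = cos (2 pi p)]. When [p] is
    uniform on [[0, 1]], the point [e^{2 pi i t(p)}] is distributed according to the
    sweeping of the unit mass at [1] onto the arc described by [[delta, 1 - delta]].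
    Consequently the function
    [kappa(x) = eta + (mean over p of l(x + t(p))) - l(x)], with
    [l(x) = ln |2 sin (pi x)|], is nonnegative, vanishes on [[delta, 1 - delta]], and
    has integral [eta] over a period ([kappa_ge0], [kappa_eq0],
    [Rintegral_kappa_unit]). In the coordinate [sinh eta * cot (pi x)] these facts
    are the classical ones about the potential of the arcsine law ([ln_sub_cos]).

    Integrate [sum_j kappa(x - theta_j)] over [[a - delta, b + delta]]. The result is
    at least [eta] times the number of [theta_j] in [[a, b]]. It is also equal to
    [N eta (b - a + 2 delta)] plus a mean of integrals of rotated copies of [u] minus
    an integral of [u], hence at most [N eta (b - a + 2 delta) + 2 h] ([count_le]).
    As [delta <= eta / pi], the excess of the number of zeros over [N (b - a)] is at
    most [2 N eta / pi + 2 h / eta], and the choice [eta = sqrt (pi h / N)] gives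
    [4 / sqrt pi * sqrt (N h)]. Lower bounds follow by passing to complements.

    That [l] is integrable with mean zero is obtained from the potentials of points
    off the circle, whose mean is given by Jensen's formula. *)

(** * Functions of period 1 *)

Section Periodic.
Context {R : realType}.
Implicit Types (f g : R -> R) (x c : R).

(** Periodicity with period 1, not necessarily the smallest. *)
Definition periodic1 f := forall x, f (x + 1) = f x.

Lemma periodic1_int f : periodic1 f -> forall x (k : int), f (x + k%:~R) = f x.
Proof.
move=> fp; have fn n x : f (x + n%:R) = f x.
  by elim: n => [|n IH]; rewrite ?addr0// -natr1 addrA fp IH.
move=> x [n|n]; first exact: fn.
by rewrite -[in RHS](subrK n.+1%:R x) fn NegzE mulrNz.
Qed.

Lemma cos2pi_periodic : periodic1 (fun x => cos (2 * pi * x)).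
Proof. by move=> x; rewrite mulrDr mulr1 mulrC [2 * _]mulrC mulr_natr cosD2pi. Qed.

Lemma sin2pi_periodic : periodic1 (fun x => sin (2 * pi * x)).
Proof. by move=> x; rewrite mulrDr mulr1 mulrC [2 * _]mulrC mulr_natr sinD2pi. Qed.

Lemma abs_sinpi_periodic : periodic1 (fun x => `|sin (pi * x)|).
Proof. by move=> x; rewrite mulrDr mulr1 sinDpi normrN. Qed.

Lemma sinpi_eq0 x : (sin (pi * x) == 0) = (x == (Num.floor x)%:~R).
Proof.
have := floor_itv x; rewrite intrD => /andP[fx xf].
have xE : x = (x - (Num.floor x)%:~R) + (Num.floor x)%:~R by rewrite subrK.
rewrite -normr_eq0 {1}xE (periodic1_int abs_sinpi_periodic) normr_eq0 -[in RHS]subr_eq0.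
move: fx xf; rewrite -subr_ge0 -ltrBlDl; set y := x - _ => y0 y1.
have [->|yn0] := eqVneq y 0; first by rewrite mulr0 sin0 eqxx.
apply/negbTE; rewrite gt_eqF// sin_gt0_pi// mulr_gt0 ?pi_gt0 ?lt0r ?yn0//=.
by rewrite gtr_pMr ?pi_gt0.
Qed.

Lemma countableU (A B : set R) : countable A -> countable B -> countable (A `|` B).
Proof.
move=> cA cB; rewrite -bigcup2E; apply: bigcup_countable => // i _.
by case: i => [|[|i]].
Qed.

Lemma countable_sinpi0 c : countable [set x : R | sin (pi * (x - c)) = 0].
Proof.
apply: (@sub_countable _ _ _ (range (fun k : int => k%:~R + c : R))).
  apply: subset_card_le => x /= /eqP; rewrite sinpi_eq0 => /eqP e.
  by exists (Num.floor (x - c)) => //; rewrite -e subrK.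
apply: sub_countable (card_image_le _ _) _; exact: countableP.
Qed.

Lemma cos2piB (p q : R) :
  cos (2 * pi * q) - cos (2 * pi * p) = 2 * sin (pi * (p - q)) * sin (pi * (p + q)).
Proof.
have -> : 2 * pi * q = pi * (p + q) - pi * (p - q) by ring.
have -> : 2 * pi * p = pi * (p + q) + pi * (p - q) by ring.
by rewrite cosB cosD; ring.
Qed.

Lemma one_sub_cos2pi x : 2 - 2 * cos (2 * pi * x) = (2 * sin (pi * x)) ^+ 2.
Proof.
have := cos2piB x 0; rewrite mulr0 cos0 subr0 addr0 => h.
by rewrite -[in X in X - _](mulr1 2) -mulrBr h; ring.
Qed.

End Periodic.

(** * Integrals over intervals and over periods *)

Section IntegralTools.
Context {R : realType}.
Implicit Types (f g : R -> R) (D N : set R) (a b c x : R).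
Notation mu := (@lebesgue_measure R).

Lemma continuous_itv_integrable f a b : continuous f ->
  mu.-integrable `[a, b] (EFin \o f).
Proof.
move=> cf; apply: continuous_compact_integrable; first exact: segment_compact.
exact: continuous_subspaceT.
Qed.

Lemma countable_measurableR N : countable N -> measurable N.
Proof. by apply: countable_measurable => t; exact: measurable_set1. Qed.

(** Countable exceptional sets occur because [ln 0 = 0]: identities between
    logarithms of products fail at the zeros of the factors. *)
Lemma le_Rintegral_off N D f g : measurable D -> countable N ->
  mu.-integrable D (EFin \o f) -> mu.-integrable D (EFin \o g) ->
  (forall x, D x -> ~ N x -> f x <= g x) ->
  \int[mu]_(x in D) f x <= \int[mu]_(x in D) g x.
Proof.
move=> mD cN intf intg fg.
have mN := countable_measurableR cN.
have N0 : mu N = 0%E by exact: countable_lebesgue_measure0.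
have E (h : R -> R) : mu.-integrable D (EFin \o h) ->
    \int[mu]_(x in D) h x = \int[mu]_(x in D `\` N) h x.
  move=> inth; rewrite /Rintegral.
  by congr fine; exact: (@negligible_integral _ _ _ mu D N (EFin \o h)).
rewrite (E f)// (E g)//; apply: le_Rintegral.
- exact: measurableD.
- by apply: integrableS intf => //; exact: measurableD.
- by apply: integrableS intg => //; exact: measurableD.
- by move=> x [Dx Nx]; exact: fg.
Qed.

Lemma eq_Rintegral_off N D f g : measurable D -> countable N ->
  mu.-integrable D (EFin \o f) -> mu.-integrable D (EFin \o g) ->
  (forall x, D x -> ~ N x -> f x = g x) ->
  \int[mu]_(x in D) f x = \int[mu]_(x in D) g x.
Proof.
move=> mD cN intf intg fg; apply/eqP; rewrite eq_le.
by apply/andP; split; apply: (le_Rintegral_off mD cN) => // x Dx Nx; rewrite fg.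
Qed.

Lemma Rintegral_itv_cat f a b c : a <= b -> b <= c ->
  mu.-integrable `[a, c] (EFin \o f) ->
  \int[mu]_(x in `[a, c]) f x =
  \int[mu]_(x in `[a, b]) f x + \int[mu]_(x in `[b, c]) f x.
Proof.
move=> ab bc intf; have := @Rintegral_itvB R f (BLeft a) (BRight c) b intf.
rewrite !bnd_simp => /(_ ab bc) /eqP; rewrite subr_eq => /eqP ->.
rewrite Rintegral_itv_obnd_cbnd; first by rewrite addrC.
apply: integrableS intf => // x /=; rewrite !in_itv/= => /andP[bx ->].
by rewrite (le_trans ab (ltW bx)).
Qed.

Lemma Rintegral_ge0_off N D f : measurable D -> countable N ->
  mu.-integrable D (EFin \o f) -> (forall x, D x -> ~ N x -> 0 <= f x) ->
  0 <= \int[mu]_(x in D) f x.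
Proof.
move=> mD cN If f0.
rewrite -[X in X <= _](_ : \int[mu]_(x in D) (fun=> 0) x = 0); last first.
  by rewrite Rintegral_cst// mul0r.
by apply: (le_Rintegral_off mD cN) => //; exact: integrable0.
Qed.

(** An integrand that is nonnegative off a countable set has a larger integral
    over a larger interval. *)
Lemma Rintegral_subitv_le N f a b c : countable N -> a <= b -> b <= c ->
  mu.-integrable `[a, c] (EFin \o f) ->
  (forall x, a <= x <= c -> ~ N x -> 0 <= f x) ->
  \int[mu]_(x in `[a, b]) f x <= \int[mu]_(x in `[a, c]) f x.
Proof.
move=> cN ab bc If f0; rewrite (Rintegral_itv_cat ab bc If) lerDl.
have bac : `[b, c] `<=` `[a, c].
  by move=> x /=; rewrite !in_itv/= => /andP[bx ->]; rewrite (le_trans ab).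
apply: (Rintegral_ge0_off _ cN) => //; first exact: integrableS If.
by move=> x /bac /=; rewrite in_itv/=; exact: f0.
Qed.

Lemma Rintegral_sum (I : Type) (s : seq I) D (F : I -> R -> R) : measurable D ->
  (forall i, mu.-integrable D (EFin \o F i)) ->
  mu.-integrable D (EFin \o (fun x => \sum_(i <- s) F i x)) /\
  \int[mu]_(x in D) (\sum_(i <- s) F i x) = \sum_(i <- s) \int[mu]_(x in D) F i x.
Proof.
move=> mD IF; elim: s => [|i s [Is Es]].
  split; last by under eq_Rintegral do rewrite big_nil; rewrite big_nil Rintegral_cst// mul0r.
  by apply: eq_integrable (integrable0 mu D) => // x _ /=; rewrite big_nil.
split.
  have : mu.-integrable D (EFin \o (fun x => F i x + \sum_(i <- s) F i x)).
    exact: (@integrableD _ _ _ mu D mD _ _ (IF i) Is).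
  by apply: eq_integrable => // x _ /=; rewrite big_cons.
by under eq_Rintegral do rewrite big_cons; rewrite big_cons RintegralD// Es.
Qed.

Lemma Rintegral_itv_cst a b r : a <= b -> \int[mu]_(x in `[a, b]) r = r * (b - a).
Proof.
rewrite le_eqVlt => /predU1P[->|ab]; rewrite Rintegral_cst//= lebesgue_measure_itv/=.
  by rewrite ltxx subrr.
by rewrite lte_fin ab.
Qed.

Lemma Rintegral_affine f (k d a b : R) : 0 < k -> a <= b -> continuous f ->
  \int[mu]_(x in `[k * a + d, k * b + d]) f x
  = k * \int[mu]_(x in `[a, b]) f (k * x + d).
Proof.
move=> k0 ab cf; pose F := fun x : R => k * x + d.
have dF x : is_derive x 1 F k.
  by rewrite /F; apply: is_derive_eq; rewrite addr0 scaler1.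
have F' : derive1 F = cst k by apply/funext => x; rewrite derive1E derive_val.
have cF : continuous F.
  by move=> x; apply: differentiable_continuous; apply/derivable1_diffP.
have := @integration_by_substitution_increasing R F f a b ab.
rewrite F' => H; rewrite /Rintegral -/(F a) -/(F b) H.
- have cfF : continuous (f \o F) by move=> x; apply: continuous_comp; [exact: cF|exact: cf].
  rewrite -[RHS]/(k * \int[mu]_(x in `[a, b]) (f \o F) x).
  rewrite -RintegralZl//; last exact: continuous_itv_integrable.
  by congr fine; apply: eq_integral => x _; rewrite /= mulrC.
- by move=> x y _ _ xy; rewrite /F ltrD2r ltr_pM2l.
- by move=> x _; exact: cvg_cst.
- exact: is_cvg_cst.
- exact: is_cvg_cst.
- split; first by move=> x _.
  + by apply: cvg_at_right_filter; exact: cF.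
  + by apply: cvg_at_left_filter; exact: cF.
- exact: continuous_subspaceT.
Qed.

Lemma Rintegral_shift f (d a b : R) : a <= b -> continuous f ->
  \int[mu]_(x in `[a, b]) f (x + d) = \int[mu]_(x in `[a + d, b + d]) f x.
Proof.
move=> ab cf; have := @Rintegral_affine f 1 d a b ltr01 ab cf; rewrite !mul1r => ->.
by apply: eq_Rintegral => x _; rewrite mul1r.
Qed.

Lemma Rintegral_period f c : continuous f -> periodic1 f ->
  \int[mu]_(x in `[c, c + 1]) f x = \int[mu]_(x in `[0, 1]) f x.
Proof.
move=> cf pf; pose k := Num.floor c; pose y := c - k%:~R.
have [y0 y1] : 0 <= y /\ y <= 1.
  have := floor_itv c; rewrite intrD => /andP[fx xf].
  by rewrite /y -/k subr_ge0 fx lerBlDl ltW.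
have -> : \int[mu]_(x in `[c, c + 1]) f x = \int[mu]_(x in `[y, y + 1]) f x.
  have -> : c = y + k%:~R by rewrite subrK.
  rewrite -[y + _ + 1]addrAC -Rintegral_shift ?lerDl//.
  by apply: eq_Rintegral => x _; rewrite periodic1_int.
have I a b := @continuous_itv_integrable f a b cf.
rewrite (@Rintegral_itv_cat f y 1)// ?lerDr//.
rewrite (@Rintegral_itv_cat f 0 y 1)// addrC; congr (_ + _).
have := @Rintegral_shift f 1 0 y y0 cf; rewrite add0r => <-.
by apply: eq_Rintegral => x _; rewrite pf.
Qed.

Lemma Rintegral_period_shift f c d : continuous f -> periodic1 f ->
  \int[mu]_(x in `[c, c + 1]) f (x + d) = \int[mu]_(x in `[0, 1]) f x.
Proof.
by move=> cf pf; rewrite Rintegral_shift ?lerDl// addrAC Rintegral_period.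
Qed.

Lemma Rintegral_period_double f : continuous f -> periodic1 f ->
  \int[mu]_(x in `[0, 1]) f (2 * x) = \int[mu]_(x in `[0, 1]) f x.
Proof.
move=> cf pf; have := @Rintegral_affine f 2 0 0 1 (ltr0n _ 2) ler01 cf.
rewrite !addr0 mulr0 mulr1.
rewrite (@Rintegral_itv_cat f 0 1 2) ?ler01 ?ler1n//; last exact: continuous_itv_integrable.
have <- := @Rintegral_period f 1 cf pf.
under [X in _ = _ * X]eq_Rintegral do rewrite addr0.
have := @Rintegral_period f 1 cf pf.
rewrite -[1 + 1]/(2%:R); lra.
Qed.

End IntegralTools.


(** * The regularised logarithmic potential of a point *)

Section Regularised.
Context {R : realType}.
Notation mu := (@lebesgue_measure R).
Implicit Types (lam x p q c : R).

(** [lreg lam x] equals [lam / 2 + ln |1 - r e^{2 pi i x}|] with [r = e^{- lam}]: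
    up to a constant, the potential at [e^{2 pi i x}] of the point [r], which
    lies off the unit circle when [0 < lam]. *)
Definition lreg lam x := 2^-1 * ln (expR lam + expR (- lam) - 2 * cos (2 * pi * x)).

(** The right-hand side is [e^lam] times the square of [|1 - r e^{2 pi i x}|]. *)
Lemma lreg_arg_factor lam x : expR lam + expR (- lam) - 2 * cos (2 * pi * x) =
  expR lam * ((1 - expR (- lam)) ^+ 2 + 2 * expR (- lam) * (1 - cos (2 * pi * x))).
Proof.
have := expRxMexpNx_1 lam; move: (expR lam) (expR _) => a b ab.
ring: ab.
Qed.

Lemma lreg_arg_gt0 lam x : 0 < lam -> 0 < expR lam + expR (- lam) - 2 * cos (2 * pi * x).
Proof.
move=> l0; rewrite lreg_arg_factor mulr_gt0 ?expR_gt0// ltr_pwDl//.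
by rewrite exprn_gt0// subr_gt0 expR_lt1 oppr_lt0.
Qed.

Lemma continuous_cos2pi : continuous (fun x : R => cos (2 * pi * x)).
Proof.
move=> x; apply: (@continuous_comp _ _ _ (fun x => 2 * pi * x) (@cos R)).
  by apply: cvgM; [exact: cvg_cst|exact: cvg_id].
exact: continuous_cos.
Qed.

Lemma continuous_lreg lam : 0 < lam -> continuous (lreg lam).
Proof.
move=> l0 x; apply: cvgM; first exact: cvg_cst.
apply: (@continuous_comp _ _ _
  (fun x => expR lam + expR (- lam) - 2 * cos (2 * pi * x)) (@ln R)).
  apply: cvgB; first exact: cvg_cst.
  by apply: cvgM; [exact: cvg_cst|exact: continuous_cos2pi].
by apply: continuous_ln; exact: lreg_arg_gt0.
Qed.

Lemma lreg_periodic lam : periodic1 (lreg lam).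
Proof. by move=> x; rewrite /lreg cos2pi_periodic. Qed.

(** The factorisation [1 - w^2 = (1 - w) (1 + w)] with [w = r e^{2 pi i x}]. *)
Lemma lreg_double lam x : 0 < lam ->
  lreg lam x + lreg lam (x + 2^-1) = lreg (2 * lam) (2 * x).
Proof.
move=> l0; rewrite /lreg -mulrDr -lnM ?posrE ?lreg_arg_gt0//; congr (_ * ln _).
have -> : 2 * pi * (x + 2^-1) = 2 * pi * x + pi by field.
have -> : 2 * pi * (2 * x) = (2 * pi * x) *+ 2 by ring.
have -> : 2 * lam = lam + lam by ring.
rewrite cosDpi cos_mulr2n opprD !expRD.
have := expRxMexpNx_1 lam; move: (expR lam) (expR _) => a b ab.
ring: ab.
Qed.

Lemma lreg_bounds lam x : 0 < lam ->
  ln (1 - expR (- lam)) <= lreg lam x - lam / 2 <= ln 2.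
Proof.
move=> l0; have el : expR (- lam) < 1 by rewrite expR_lt1 oppr_lt0.
have e0 := expR_gt0 (- lam).
have c1 := cos_le1 (2 * pi * x); have cN1 := cos_geN1 (2 * pi * x).
rewrite /lreg lreg_arg_factor.
set w := (_ + _ * _); have w1 : (1 - expR (- lam)) ^+ 2 <= w by rewrite /w; nra.
have w2 : w <= 2 ^+ 2 by rewrite /w; nra.
have w0 : 0 < w by apply: lt_le_trans w1; rewrite exprn_gt0// subr_gt0.
rewrite lnM ?posrE ?expR_gt0// expRK.
have -> : 2^-1 * (lam + ln w) - lam / 2 = 2^-1 * ln w by field.
have lw1 : ln ((1 - expR (- lam)) ^+ 2) <= ln w.
  by rewrite ler_ln ?posrE ?exprn_gt0 ?subr_gt0.
have lw2 : ln w <= ln (2 ^+ 2) by rewrite ler_ln ?posrE ?exprn_gt0.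
rewrite lnXn ?subr_gt0// in lw1; rewrite lnXn// in lw2.
by apply/andP; split; lra.
Qed.

Lemma Rintegral_lreg_double lam : 0 < lam ->
  \int[mu]_(x in `[0, 1]) lreg (2 * lam) x = 2 * \int[mu]_(x in `[0, 1]) lreg lam x.
Proof.
move=> l0; have l20 : 0 < 2 * lam by rewrite mulr_gt0.
have cl := @continuous_lreg lam l0.
rewrite -(@Rintegral_period_double _ (lreg (2 * lam))); last 2 first.
- exact: continuous_lreg.
- exact: lreg_periodic.
under eq_Rintegral do rewrite -lreg_double//.
rewrite RintegralD//.
- have := @Rintegral_period_shift R (lreg lam) 0 2^-1 cl (@lreg_periodic lam).
  by rewrite add0r => ->; ring.
- exact: continuous_itv_integrable.
- apply: continuous_itv_integrable => x.
  apply: (@continuous_comp _ _ _ (fun x => x + 2^-1) (lreg lam)); last exact: cl.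
  by apply: cvgD; [exact: cvg_id|exact: cvg_cst].
Qed.

(** Jensen's formula for one point. The defect [E lam] of the formula satisfies
    [E (2 * lam) = 2 * E lam] by [lreg_double] and is bounded on every half-line
    away from [0], hence it vanishes. *)
Lemma Rintegral_lreg01 lam : 0 < lam -> \int[mu]_(x in `[0, 1]) lreg lam x = lam / 2.
Proof.
move=> l0; have [E EE] : exists E, forall l, E l = \int[mu]_(x in `[0, 1]) lreg l x - l / 2.
  by eexists.
have [C [C1 C2]] : exists C : R, ln 2 <= C /\ - ln (1 - expR (- lam)) <= C.
  by exists (Num.max (ln 2) (- ln (1 - expR (- lam)))); rewrite !le_max !lexx orbT.
have Ebound l : lam <= l -> `|E l| <= C.
  move=> ll; have lp : 0 < l by exact: lt_le_trans ll.
  have I1 : mu.-integrable `[0, 1] (EFin \o lreg l).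
    by apply: continuous_itv_integrable; exact: continuous_lreg.
  have Ic r : mu.-integrable `[0, 1] (EFin \o (fun=> r : R)).
    by apply: continuous_itv_integrable => x; exact: cvg_cst.
  have hl : \int[mu]_(x in `[0, 1]) (l / 2 - C) <= \int[mu]_(x in `[0, 1]) lreg l x.
    apply: le_Rintegral => // x _; have /andP[h _] := lreg_bounds x lp.
    have : - C <= ln (1 - expR (- l)).
      apply: le_trans (_ : ln (1 - expR (- lam)) <= _); first by rewrite lerNl.
      rewrite ler_ln ?posrE.
      - by rewrite lerD2l lerN2 ler_expR lerN2.
      - by rewrite subr_gt0 expR_lt1 oppr_lt0.
      - by rewrite subr_gt0 expR_lt1 oppr_lt0.
    lra.
  have hu : \int[mu]_(x in `[0, 1]) lreg l x <= \int[mu]_(x in `[0, 1]) (l / 2 + C).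
    apply: le_Rintegral => // x _; have /andP[_ h] := lreg_bounds x lp.
    lra.
  rewrite ler_norml EE; move: hl hu; rewrite !Rintegral_itv_cst ?ler01// subr0 !mulr1.
  by move: (Rintegral _ _ _) => I hl hu; apply/andP; split; lra.
have Edbl k : E lam = E (2 ^+ k * lam) / 2 ^+ k.
  elim: k => [|k ->]; first by rewrite expr0 mul1r divr1.
  have k0 : 0 < 2 ^+ k :> R by exact: exprn_gt0.
  rewrite exprS -[in RHS]mulrA !EE Rintegral_lreg_double ?mulr_gt0//.
  by field; rewrite gt_eqF.
have C0 : 0 <= C by apply: le_trans C1; rewrite ln_ge0// ler1n.
apply/eqP; rewrite -subr_eq0 -EE -normr_le0; apply/ler_addgt0Pr => e e0.
rewrite add0r; have [n Cn] : exists n : nat, C / e <= n%:R.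
  exists (Num.truncn (C / e)).+1; apply: ltW; exact: truncnS_gt.
have n2 : n%:R <= 2 ^+ n :> R by rewrite -natrX ler_nat ltnW// ltn_expl.
have p0 : 0 < 2 ^+ n :> R by exact: exprn_gt0.
rewrite (Edbl n) normrM normfV (gtr0_norm p0) ler_pdivrMr//.
apply: le_trans (Ebound _ _) _; first by rewrite ler_peMl ?(ltW l0)// exprn_ege1// ler1n.
by rewrite mulrC -ler_pdivrMr// (le_trans Cn).
Qed.

Lemma Rintegral_lreg lam c d : 0 < lam ->
  \int[mu]_(x in `[c, c + 1]) lreg lam (x - d) = lam / 2.
Proof.
move=> l0; rewrite Rintegral_period_shift ?Rintegral_lreg01//.
- exact: continuous_lreg.
- exact: lreg_periodic.
Qed.

End Regularised.


(** * The logarithmic potential of a point of the circle *)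

Section LogSine.
Context {R : realType}.
Notation mu := (@lebesgue_measure R).
Implicit Types (lam x p q c d : R).

(** [logsin (x - d)] is the potential [ln |e^{2 pi i x} - e^{2 pi i d}|]; at the
    singularity it takes the value [ln 0 = 0] instead of minus infinity. *)
Definition logsin x := ln `|2 * sin (pi * x)|.

Lemma measurable_logsin : measurable_fun [set: R] logsin.
Proof.
apply: (measurableT_comp (@measurable_ln R)).
apply: (measurableT_comp (@normr_measurable R setT)).
apply: continuous_measurable_fun => x.
apply: cvgM; first exact: cvg_cst.
apply: (@continuous_comp _ _ _ (fun x => pi * x) (@sin R)).
  by apply: cvgM; [exact: cvg_cst|exact: cvg_id].
exact: continuous_sin.
Qed.

Lemma logsin_le x : logsin x <= ln 2.
Proof.
rewrite /logsin; have [->|s0] := eqVneq (sin (pi * x)) 0.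
  by rewrite mulr0 normr0 ln0// ln_ge0// ler1n.
rewrite ler_ln ?posrE ?normr_gt0 ?mulf_neq0 ?pnatr_eq0//.
by rewrite normrM ger0_norm// ler_piMr// sin_max.
Qed.

Lemma logsinN x : logsin (- x) = logsin x.
Proof. by rewrite /logsin mulrN sinN mulrN normrN. Qed.

Lemma logsin_cos x : logsin x = 2^-1 * ln (2 - 2 * cos (2 * pi * x)).
Proof.
rewrite /logsin one_sub_cos2pi -real_normK ?num_real//.
have [->|s0] := eqVneq `|2 * sin (pi * x)| 0; first by rewrite expr0n/= ln0 ?mulr0.
by rewrite lnXn ?lt0r ?s0//=; field.
Qed.

Lemma sum_expR_ge2 lam : 2 <= expR lam + expR (- lam).
Proof.
have := expRxMexpNx_1 lam; have := expR_gt0 lam; have := expR_gt0 (- lam).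
move: (expR lam) (expR _) => a b a0 b0 ab.
have : 0 <= (a - b) ^+ 2 by exact: sqr_ge0.
have -> : (a - b) ^+ 2 = (a + b) ^+ 2 - 4 * (a * b) by ring.
rewrite ab => h; nra.
Qed.

Lemma logsin_le_lreg lam x : sin (pi * x) != 0 -> logsin x <= lreg lam x.
Proof.
move=> s0; rewrite logsin_cos /lreg ler_pM2l//.
have p0 : 0 < 2 - 2 * cos (2 * pi * x).
  by rewrite one_sub_cos2pi exprn_even_gt0//= mulf_neq0// pnatr_eq0.
have h := sum_expR_ge2 lam.
by rewrite ler_ln ?posrE//; [lra|lra].
Qed.

Lemma lreg_cvg x : sin (pi * x) != 0 -> lreg (n.+1%:R^-1) x @[n --> \oo] --> logsin x.
Proof.
move=> s0; rewrite logsin_cos /lreg.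
have p0 : 0 < 2 - 2 * cos (2 * pi * x).
  by rewrite one_sub_cos2pi exprn_even_gt0//= mulf_neq0// pnatr_eq0.
apply: cvgM; first exact: cvg_cst.
apply: (@continuous_cvg _ _ _ _ _ _ (@ln R)); first exact: continuous_ln.
apply: cvgB; last exact: cvg_cst.
have h : (n.+1%:R^-1 : R) @[n --> \oo] --> (0 : R) by exact: cvg_harmonic.
have e0 : (2 : R) = expR 0 + expR (- 0) by rewrite oppr0 expR0.
rewrite [X in _ --> X]e0; apply: cvgD.
  by apply: (@continuous_cvg _ _ _ _ _ _ (@expR R)); [exact: continuous_expR|].
apply: (@continuous_cvg _ _ _ _ _ _ (@expR R)); first exact: continuous_expR.
exact: cvgN.
Qed.

Lemma measurable_logsin_sub d : measurable_fun [set: R] (fun x => logsin (x - d)).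
Proof.
apply: (measurableT_comp measurable_logsin).
apply: continuous_measurable_fun => x.
by apply: cvgB; [exact: cvg_id|exact: cvg_cst].
Qed.

Lemma cst_integrable (r a b : R) : mu.-integrable `[a, b] (EFin \o (fun=> r)).
Proof. by apply: continuous_itv_integrable => x; exact: cvg_cst. Qed.

Lemma lreg_shift_integrable lam d a b : 0 < lam ->
  mu.-integrable `[a, b] (EFin \o (fun x => lreg lam (x - d))).
Proof.
move=> l0; apply: continuous_itv_integrable => x.
apply: (@continuous_comp _ _ _ (fun x => x - d) (lreg lam)).
  by apply: cvgB; [exact: cvg_id|exact: cvg_cst].
exact: continuous_lreg.
Qed.

(** Fatou's lemma applied to [K - lreg lam] as [lam] decreases to [0]; [K] is
    chosen so that these functions are nonnegative for [lam <= 1]. *)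
Lemma logsin_unit c d :
  mu.-integrable `[c, c + 1] (EFin \o (fun x => logsin (x - d))) /\
  0 <= \int[mu]_(x in `[c, c + 1]) logsin (x - d).
Proof.
pose D : set R := `[c, c + 1]%classic.
pose N : set R := [set x | sin (pi * (x - d)) = 0].
have cN : countable N by exact: countable_sinpi0.
have mN := countable_measurableR cN.
have N0 : mu N = 0%E by exact: countable_lebesgue_measure0.
have mD : measurable D by exact: measurable_itv.
have mDN : measurable (D `\` N) by exact: measurableD.
have [K K2] : exists K : R, K = ln 2 + 2^-1 by eexists.
pose f n x := (K - lreg (n.+1%:R^-1) (x - d))%:E.
have l0 n : 0 < n.+1%:R^-1 :> R by rewrite invr_gt0.
have f0 n x : (0 <= f n x)%E.
  rewrite lee_fin K2; have /andP[_] := lreg_bounds (x - d) (l0 n).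
  have : n.+1%:R^-1 <= 1 :> R by rewrite invf_le1// ler1n.
  by move: (n.+1%:R^-1 : R) => u ? ?; lra.
have If n : mu.-integrable D (f n).
  exact: (@integrableB _ _ _ mu D mD _ _ (cst_integrable K c (c + 1))
    (lreg_shift_integrable d c (c + 1) (l0 n))).
have Ef n : (\int[mu]_(x in D `\` N) f n x = (K - n.+1%:R^-1 / 2)%:E)%E.
  have <- := @negligible_integral _ _ _ mu D N (f n) mN mD (If n) N0.
  rewrite -(fineK (integrable_fin_num _ (If n)))//.
  have := @RintegralB _ _ _ mu D (fun=> K) (fun x => lreg (n.+1%:R^-1) (x - d)) mD.
  rewrite /Rintegral => ->.
  - rewrite -/(Rintegral mu D (fun=> K)) -/(Rintegral mu D _) /D.
    by rewrite Rintegral_itv_cst ?lerDl// Rintegral_lreg// [c + 1]addrC addrK mulr1.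
  - exact: cst_integrable.
  - exact: lreg_shift_integrable.
have fat := @fatou _ _ _ mu (D `\` N) mDN f.
have h0 x : 0 <= K - logsin (x - d).
  by have := logsin_le (x - d); rewrite K2; lra.
have mh : measurable_fun [set: R] (fun x => K - logsin (x - d)).
  by apply: measurable_funB => //; exact: measurable_logsin_sub.
have IK : (\int[mu]_(x in D `\` N) (K - logsin (x - d))%:E <= K%:E)%E.
  rewrite (_ : integral _ _ _ = \int[mu]_(x in D `\` N) limn_einf (f^~ x))%E; last first.
    apply: eq_integral => x; rewrite inE => -[_ /= /eqP Nx].
    suff cv : f n x @[n --> \oo] --> (K - logsin (x - d))%:E.
      by have [-> _] := cvg_limn_einf_sup cv.
    apply: cvg_EFin; first exact: nearW.
    by apply: cvgB; [exact: cvg_cst|exact: lreg_cvg].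
  apply: le_trans (fat _ _) _ => //.
    by move=> n; apply: (measurable_int mu); apply: integrableS (If n).
  have -> : (fun n => \int[mu]_(x in D `\` N) f n x)%E = (fun n => (K - n.+1%:R^-1 / 2)%:E).
    by apply/funext.
  suff cv : (K - n.+1%:R^-1 / 2 : R)%:E @[n --> \oo] --> K%:E.
    by have [-> _] := cvg_limn_einf_sup cv.
  apply: cvg_EFin; first exact: nearW.
  rewrite -[X in _ --> X]subr0; apply: cvgB; first exact: cvg_cst.
  rewrite -(mul0r (2^-1)); apply: cvgM; last exact: cvg_cst.
  exact: cvg_harmonic.
have IhN : mu.-integrable (D `\` N) (EFin \o (fun x => K - logsin (x - d))).
  apply/integrableP; split.
    by apply/measurable_EFinP; apply: measurable_funS mh.
  apply: le_lt_trans (ltry K); apply: le_trans IK.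
  rewrite le_eqVlt; apply/orP; left; apply/eqP; apply: eq_integral => x _ /=.
  by rewrite ger0_norm.
have Ih : mu.-integrable D (EFin \o (fun x => K - logsin (x - d))).
  apply/(@negligible_integrable _ _ _ mu D N) => //.
  by apply/measurable_EFinP; apply: measurable_funS mh.
have Il : mu.-integrable D (EFin \o (fun x => logsin (x - d))).
  have := @integrableB _ _ _ mu D mD _ _ (cst_integrable K c (c + 1)) Ih.
  by apply: eq_integrable => // x _ /=; rewrite -EFinB; congr EFin; ring.
split=> //.
have EN := @negligible_integral _ _ _ mu D N _ mN mD Ih N0.
move: IK; rewrite -EN.
rewrite -(fineK (integrable_fin_num _ Ih))// lee_fin.
rewrite -[fine _]/(Rintegral mu D (fun x => K - logsin (x - d))) RintegralB//; last first.
  exact: cst_integrable.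
rewrite Rintegral_itv_cst ?lerDl//.
by move: (Rintegral _ _ _) => I; lra.
Qed.

Lemma logsin_integrable_unit c d :
  mu.-integrable `[c, c + 1] (EFin \o (fun x => logsin (x - d))).
Proof. by have [] := logsin_unit c d. Qed.

(** The potential of a point of the unit circle has mean zero on the circle. *)
Lemma Rintegral_logsin c d : \int[mu]_(x in `[c, c + 1]) logsin (x - d) = 0.
Proof.
have [Il Il0] := logsin_unit c d; apply/eqP; rewrite eq_le Il0 andbT.
apply/ler_addgt0Pr => e e0; rewrite add0r.
have e20 : 0 < 2 * e by rewrite mulr_gt0.
have -> : e = 2 * e / 2 by field.
rewrite -(@Rintegral_lreg _ (2 * e) c d)//.
apply: (le_Rintegral_off _ (countable_sinpi0 d)) => //.
- exact: lreg_shift_integrable.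
- by move=> x _ /= /eqP; exact: logsin_le_lreg.
Qed.

End LogSine.


(** * Nodes and half-width *)

Section Kernel.
Context {R : realType}.
Notation mu := (@lebesgue_measure R).
Implicit Types (eta tau theta x p q c d y : R).

(** Hyperbolic sine. *)
Definition sinh eta : R := (expR eta - expR (- eta)) / 2.

(** The half-width [delta] of the kernel: [tan (pi * delta) = sinh eta]. *)
Definition halfwidth eta : R := atan (sinh eta) / pi.

(** The solution [t] in [[delta, 1 - delta]] of
    [sinh eta * cot (pi * t) = cos (2 * pi * p)]. As [p] runs over [[0, 1]], the
    point [e^{2 pi i t}] is distributed according to the sweeping of the unit mass
    at [1] onto the arc of those [e^{2 pi i t}] with [delta <= t <= 1 - delta]. *)
Definition node eta p : R := 2^-1 - atan (cos (2 * pi * p) / sinh eta) / pi.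

(** The function [p |-> ln 2 + ln (sinh eta ^ 2 + cos (2 pi p) ^ 2) / 2] (see
    [weightE]), written with [lreg] so that its mean is known. *)
Definition weight eta p : R := lreg (2 * eta) (2 * (p + 4^-1)).

Lemma sinh_gt0 eta : 0 < eta -> 0 < sinh eta.
Proof. by move=> e0; rewrite divr_gt0// subr_gt0 ltr_expR; lra. Qed.

Lemma weightE eta p : 0 < eta ->
  2^-1 * ln (sinh eta ^+ 2 + cos (2 * pi * p) ^+ 2) = weight eta p - ln 2.
Proof.
move=> e0; have s0 := sinh_gt0 e0.
have w0 : 0 < sinh eta ^+ 2 + cos (2 * pi * p) ^+ 2.
  by rewrite ltr_pwDl ?sqr_ge0// exprn_gt0.
rewrite /weight /lreg; have -> : expR (2 * eta) + expR (- (2 * eta)) -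
    2 * cos (2 * pi * (2 * (p + 4^-1))) = 2 ^+ 2 * (sinh eta ^+ 2 + cos (2 * pi * p) ^+ 2).
  have -> : 2 * pi * (2 * (p + 4^-1)) = (2 * pi * p) *+ 2 + pi :> R by field.
  have -> : 2 * eta = eta + eta by ring.
  rewrite cosDpi cos_mulr2n opprD !expRD /sinh.
  have := expRxMexpNx_1 eta; move: (expR eta) (expR _) => a b ab.
  by field: ab.
by rewrite lnM ?posrE ?exprn_gt0// lnXn// mulrDr mulr2n; field.
Qed.

Lemma weight_integrable eta : 0 < eta -> mu.-integrable `[0, 1] (EFin \o weight eta).
Proof.
move=> e0; apply: continuous_itv_integrable => p.
apply: (@continuous_comp _ _ _ (fun p => 2 * (p + 4^-1)) (lreg (2 * eta))).
  apply: cvgM; first exact: cvg_cst.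
  by apply: cvgD; [exact: cvg_id|exact: cvg_cst].
by apply: continuous_lreg; rewrite mulr_gt0.
Qed.

Lemma Rintegral_weight eta : 0 < eta -> \int[mu]_(p in `[0, 1]) weight eta p = eta.
Proof.
move=> e0; rewrite /weight; under eq_Rintegral do rewrite -lreg_double// -addrA.
have I d : \int[mu]_(p in `[0, 1]) lreg eta (p + d) = eta / 2.
  have := Rintegral_lreg 0 (- d) e0; rewrite add0r => <-.
  by under [in RHS]eq_Rintegral do rewrite opprK.
rewrite RintegralD//; first by rewrite !I; field.
all: have := @lreg_shift_integrable R eta _ 0 1 e0 => H.
- by have := H (- 4^-1); apply: eq_integrable => // p _ /=; rewrite opprK.
- by have := H (- (4^-1 + 2^-1)); apply: eq_integrable => // p _ /=; rewrite opprK.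
Qed.

Lemma sin_node eta tau p : 0 < eta ->
  sin (pi * (node eta p - tau)) *
    Num.sqrt (sinh eta ^+ 2 + cos (2 * pi * p) ^+ 2) =
  sinh eta * cos (pi * tau) - cos (2 * pi * p) * sin (pi * tau).
Proof.
move=> e0; have s0 := sinh_gt0 e0.
rewrite /node; set a := atan _; set c := cos (2 * pi * p); set s := sinh eta.
have sn0 : s != 0 by rewrite gt_eqF.
have -> : pi * (2^-1 - a / pi - tau) = pi / 2 - (a + pi * tau).
  by have := lt0r_neq0 (pi_gt0 R); move: (pi : R) => P P0; field.
rewrite sinB sin_pihalf cos_pihalf mul1r mul0r subr0 cosD.
have ca : cos a = s / Num.sqrt (s ^+ 2 + c ^+ 2).
  rewrite cos_atan -/s -/c.
  have -> : 1 + (c / s) ^+ 2 = (s ^+ 2 + c ^+ 2) / s ^+ 2 by field.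
  by rewrite sqrtrM ?addr_ge0 ?sqr_ge0// sqrtrV ?sqr_ge0// sqrtr_sqr gtr0_norm// invfM invrK mulrC.
have cn0 : cos a != 0.
  rewrite gt_eqF// cos_gt0_pihalf//.
  by rewrite atan_gtNpi2 atan_ltpi2.
have sa : sin a = c / s * cos a.
  have <- : tan a = c / s by rewrite atanK.
  by rewrite /tan divfK.
have r0 : Num.sqrt (s ^+ 2 + c ^+ 2) != 0.
  by rewrite gt_eqF// sqrtr_gt0 ltr_pwDl ?sqr_ge0// exprn_gt0.
rewrite sa ca; move: (Num.sqrt _) r0 => r r0.
by field; rewrite r0 sn0.
Qed.

(** The potential at a node, the singularity being at [tau]. If [sin (pi tau)] is
    nonzero, [u] is its product with [y - cos (2 pi p)], where
    [y = sinh eta * cot (pi tau)]. *)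
Lemma logsin_node eta tau p : 0 < eta ->
  let u := sinh eta * cos (pi * tau) - cos (2 * pi * p) * sin (pi * tau) in
  u != 0 -> logsin (node eta p - tau) = 2 * ln 2 + ln `|u| - weight eta p.
Proof.
move=> e0 u u0; have s0 := sinh_gt0 e0.
have w0 : 0 < sinh eta ^+ 2 + cos (2 * pi * p) ^+ 2.
  by rewrite ltr_pwDl ?sqr_ge0// exprn_gt0.
have := sin_node tau p e0; rewrite -/u; set sn := sin _; set r := Num.sqrt _ => snu.
have r0 : 0 < r by rewrite sqrtr_gt0.
have sn0 : sn != 0 by apply: contraNneq u0 => sn0; rewrite -snu sn0 mul0r.
have -> : ln `|u| = logsin (node eta p - tau) - ln 2 + ln r.
  rewrite /logsin -/sn -snu !normrM (gtr0_norm r0) (ger0_norm (ler0n _ 2)).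
  by rewrite !lnM ?posrE ?mulr_gt0 ?normr_gt0//; ring.
have -> : ln r = weight eta p - ln 2.
  rewrite -weightE// -[in RHS](sqr_sqrtr (ltW w0)) -/r lnXn//.
  by rewrite mulr2n; field.
by ring.
Qed.

Lemma ln_cos2piB p q : sin (pi * (p - q)) != 0 -> sin (pi * (p + q)) != 0 ->
  ln `|cos (2 * pi * q) - cos (2 * pi * p)| = logsin (p - q) + logsin (p + q) - ln 2.
Proof.
move=> s1 s2; rewrite cos2piB /logsin !normrM (ger0_norm (ler0n _ 2)).
by rewrite !lnM ?posrE ?mulr_gt0 ?normr_gt0//; ring.
Qed.

End Kernel.


(** * The mean of the potential over the nodes *)

Section KernelIntegral.
Context {R : realType}.
Notation mu := (@lebesgue_measure R).
Implicit Types (eta tau theta x p q c d y : R).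

Lemma cos2pi_surj y : `|y| <= 1 -> exists q, cos (2 * pi * q) = y.
Proof.
rewrite ler_norml => y1; exists (acos y / (2 * pi)).
have p0 : pi != 0 :> R by rewrite lt0r_neq0// pi_gt0.
by rewrite [_ * (_ / _)]mulrC divfK ?mulf_neq0 ?pnatr_eq0// acosK.
Qed.

Lemma countable_cos2pi y : countable [set p : R | cos (2 * pi * p) = y].
Proof.
have [[q <-]|nq] := pselect (exists q, cos (2 * pi * q) = y); last first.
  rewrite (_ : [set _ | _] = set0)//; apply/seteqP; split => // p /= py.
  by apply: nq; exists p.
have := countableU (countable_sinpi0 q) (countable_sinpi0 (- q)).
apply: sub_countable; apply: subset_card_le => p /= /esym/eqP.
rewrite -subr_eq0 cos2piB -mulrA mulf_eq0 pnatr_eq0/= mulf_eq0 opprK.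
by move=> /orP[] /eqP; [left|right].
Qed.

Lemma ln_abs_continuous (f : R -> R) x : f x != 0 -> {for x, continuous f} ->
  {for x, continuous (fun x => ln `|f x|)}.
Proof.
move=> fx cf; apply: (@continuous_comp _ _ _ (fun x => `|f x|) (@ln R)).
  by apply: continuous_comp; [exact: cf|exact: norm_continuous].
by apply: continuous_ln; rewrite normr_gt0.
Qed.

Lemma logsin_pair_integrable q : mu.-integrable `[0, 1]
  (EFin \o (fun p => logsin (p - q) + logsin (p - - q) - ln 2)).
Proof.
have I d := @logsin_integrable_unit R 0 d; rewrite add0r in I.
have := @integrableB _ _ _ mu `[0, 1]%classic _ _ _
  (@integrableD _ _ _ mu `[0, 1]%classic _ _ _ (I q) (I (- q))) (@cst_integrable R (ln 2) 0 1).
by apply.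
Qed.

Lemma Rintegral_logsin_pair q :
  \int[mu]_(p in `[0, 1]) (logsin (p - q) + logsin (p - - q) - ln 2) = - ln 2.
Proof.
have I d := @logsin_integrable_unit R 0 d; rewrite add0r in I.
have E d := @Rintegral_logsin R 0 d; rewrite add0r in E.
rewrite RintegralB//; last 2 first.
- exact: (@integrableD _ _ _ mu `[0, 1]%classic _ _ _ (I q) (I (- q))).
- exact: cst_integrable.
by rewrite RintegralD// !E Rintegral_itv_cst ?ler01// subr0 mulr1 addr0 sub0r.
Qed.

(** The logarithmic potential of the arcsine law is [- ln 2] on [[-1, 1]], and it
    is not smaller elsewhere. On [[-1, 1]] one writes [y = cos (2 pi q)] and
    factors the difference of cosines into two sines; elsewhere [y] is compared
    with the nearest point of [[-1, 1]]. *)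
Lemma ln_sub_cos y :
  let Y p := ln `|y - cos (2 * pi * p)| in
  [/\ mu.-integrable `[0, 1] (EFin \o Y),
      - ln 2 <= \int[mu]_(p in `[0, 1]) Y p &
      `|y| <= 1 -> \int[mu]_(p in `[0, 1]) Y p = - ln 2].
Proof.
move=> Y.
have cY p : {for p, continuous (fun p => y - cos (2 * pi * p))}.
  by apply: cvgB; [exact: cvg_cst|exact: continuous_cos2pi].
have mY : measurable_fun [set: R] Y.
  apply: (measurableT_comp (@measurable_ln R)).
  apply: (measurableT_comp (@normr_measurable R setT)).
  exact: continuous_measurable_fun.
(* The nearest point of [[-1, 1]]. *)
pose y0 := Num.max (-1) (Num.min y 1).
have y01 : `|y0| <= 1.
  by rewrite ler_norml /y0 le_max lexx/= ge_max ge_min lexx orbT andbT; lra.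
have y0y p : `|y0 - cos (2 * pi * p)| <= `|y - cos (2 * pi * p)|.
  have := cos_le1 (2 * pi * p); have := cos_geN1 (2 * pi * p).
  move: (cos _) => c c1 c2; rewrite /y0.
  have [y1|y1] := leP y 1.
    have [y2|y2] := leP (-1) y => //.
    by rewrite (ler0_norm (_ : -1 - c <= 0)) ?(ler0_norm (_ : y - c <= 0)); lra.
  have [y2|y2] := leP (-1 : R) 1; last by lra.
  by rewrite (ger0_norm (_ : 0 <= 1 - c)) ?(ger0_norm (_ : 0 <= y - c)); lra.
have [q qy] := cos2pi_surj y01.
pose r p := logsin (p - q) + logsin (p - - q) - ln 2.
have Ir : mu.-integrable `[0, 1] (EFin \o r) by exact: logsin_pair_integrable.
pose N := [set p | sin (pi * (p - q)) = 0] `|` [set p | sin (pi * (p - - q)) = 0].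
have cN : countable N by apply: countableU; exact: countable_sinpi0.
have rE p : ~ N p -> r p = ln `|y0 - cos (2 * pi * p)| /\ 0 < `|y0 - cos (2 * pi * p)|.
  move=> Np; have s1 : sin (pi * (p - q)) != 0 by apply/eqP => ?; apply: Np; left.
  have s2 : sin (pi * (p + q)) != 0.
    by apply/eqP => ?; apply: Np; right; rewrite /= opprK.
  rewrite /r opprK -qy ln_cos2piB//; split=> //.
  by rewrite normr_gt0 cos2piB !mulf_neq0// pnatr_eq0.
have IY : mu.-integrable `[0, 1] (EFin \o Y).
  have [y1|y1] := leP `|y| 1.
    have y0E : y0 = y.
      move: y1; rewrite ler_norml /y0 => /andP[y1 y2].
      by rewrite (min_idPl y2) (max_idPr y1).
    apply: (@le_integrable _ _ _ mu `[0, 1]%classic _ _ (EFin \o r)) => //.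
      by apply/measurable_EFinP; apply: measurable_funS mY.
    move=> p _ /=; rewrite lee_fin; have [Np|/rE[-> _]] := pselect (N p).
      rewrite /Y -y0E -qy cos2piB; suff -> : 2 * sin (pi * (p - q)) * sin (pi * (p + q)) = 0.
        by rewrite normr0 ln0// normr0.
      by case: Np => /=; rewrite ?opprK => ->; rewrite ?mulr0 ?mul0r.
    by rewrite y0E.
  apply: continuous_itv_integrable => p.
  apply: (@ln_abs_continuous (fun p => y - cos (2 * pi * p)) p (_ : _ != 0) (cY p)).
  apply: contraTneq y1 => /eqP; rewrite subr_eq0 => /eqP ->.
  by rewrite -leNgt cos_max.
have rY : \int[mu]_(p in `[0, 1]) r p <= \int[mu]_(p in `[0, 1]) Y p.
  apply: (le_Rintegral_off _ cN) => // p _ /rE[-> p0].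
  by rewrite /Y ler_ln ?posrE// (lt_le_trans p0).
have rI : \int[mu]_(p in `[0, 1]) r p = - ln 2 by exact: Rintegral_logsin_pair.
split => //; first by rewrite -rI.
rewrite ler_norml => /andP[y1 y2]; rewrite -rI; apply/esym.
apply: (eq_Rintegral_off _ cN) => // p _ /rE[-> _].
by rewrite /y0 (min_idPl y2) (max_idPr y1).
Qed.

Lemma continuous_node eta : 0 < eta -> continuous (node eta).
Proof.
move=> e0 p; apply: cvgB; first exact: cvg_cst.
apply: cvgM; last exact: cvg_cst.
apply: (@continuous_comp _ _ _ (fun p => cos (2 * pi * p) / sinh eta) (@atan R)).
  by apply: cvgM; [exact: continuous_cos2pi|exact: cvg_cst].
exact: continuous_atan.
Qed.

Lemma measurable_logsin_node eta tau : 0 < eta ->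
  measurable_fun [set: R] (fun p => logsin (node eta p - tau)).
Proof.
move=> e0; apply: (measurableT_comp measurable_logsin).
apply: continuous_measurable_fun => p.
by apply: cvgB; [exact: continuous_node|exact: cvg_cst].
Qed.

(** The defining property of the nodes: averaging the potential over them
    subtracts the constant [eta] where [tau] lies in the arc carrying the nodes, and
    at most [eta] elsewhere. *)
Lemma logsin_node_integral eta tau : 0 < eta -> sin (pi * tau) != 0 ->
  let G p := logsin (node eta p - tau) in
  [/\ mu.-integrable `[0, 1] (EFin \o G),
      logsin tau - eta <= \int[mu]_(p in `[0, 1]) G p &
      `|sinh eta * cos (pi * tau)| <= `|sin (pi * tau)| ->
      \int[mu]_(p in `[0, 1]) G p = logsin tau - eta].
Proof.
move=> e0 t0 G; pose y := sinh eta * cos (pi * tau) / sin (pi * tau).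
have [IY leY eqY] := ln_sub_cos y.
set Y := fun p => ln `|y - cos (2 * pi * p)| in IY leY eqY.
pose F p := (logsin tau + ln 2) + Y p - weight eta p.
pose u p := sinh eta * cos (pi * tau) - cos (2 * pi * p) * sin (pi * tau).
have uE p : u p = sin (pi * tau) * (y - cos (2 * pi * p)) by rewrite /u /y; field.
pose N := [set p : R | cos (2 * pi * p) = y].
have cN : countable N by exact: countable_cos2pi.
have GF p : ~ N p -> G p = F p.
  move=> Np; have yc : y - cos (2 * pi * p) != 0.
    by rewrite subr_eq0 eq_sym; apply/eqP.
  have u0 : u p != 0 by rewrite uE mulf_neq0.
  rewrite /G (logsin_node e0 u0) -/(u p) uE /F /Y /logsin !normrM.
  by rewrite !lnM ?posrE ?normr_gt0//; rewrite (ger0_norm (ler0n _ 2)); ring.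
have G0 p : N p -> G p = 0.
  move=> Np; have := sin_node tau p e0; rewrite -/(u p) uE Np subrr mulr0 => /eqP.
  rewrite mulf_eq0 => /orP[/eqP s0|]; first by rewrite /G /logsin s0 mulr0 normr0 ln0.
  by rewrite gt_eqF// sqrtr_gt0 ltr_pwDl ?sqr_ge0// exprn_gt0// sinh_gt0.
have IcY : mu.-integrable `[0, 1] (EFin \o (fun p => logsin tau + ln 2 + Y p)).
  exact: (@integrableD _ _ _ mu `[0, 1]%classic _ _ _ (@cst_integrable R _ 0 1) IY).
have IW := weight_integrable e0.
have IF : mu.-integrable `[0, 1] (EFin \o F).
  exact: (@integrableB _ _ _ mu `[0, 1]%classic _ _ _ IcY IW).
have IG : mu.-integrable `[0, 1] (EFin \o G).
  apply: (@le_integrable _ _ _ mu `[0, 1]%classic _ _ (EFin \o F)) => //.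
    by apply/measurable_EFinP; apply: measurable_funS (measurable_logsin_node tau e0).
  move=> p _ /=; rewrite lee_fin; have [/G0 ->|/GF -> //] := pselect (N p).
  by rewrite normr0.
have FI : \int[mu]_(p in `[0, 1]) F p =
    logsin tau + ln 2 + \int[mu]_(p in `[0, 1]) Y p - eta.
  rewrite RintegralB// Rintegral_weight// RintegralD//; last exact: cst_integrable.
  by rewrite Rintegral_itv_cst ?ler01// subr0 mulr1.
have EGF : \int[mu]_(p in `[0, 1]) G p = \int[mu]_(p in `[0, 1]) F p.
  by apply: (eq_Rintegral_off _ cN) => // p _ /GF.
split => //; rewrite EGF FI.
  by move: leY; move: (Rintegral _ _ _) => I ?; lra.
move=> h; rewrite eqY; first by ring.
by rewrite /y normf_div ler_pdivrMr ?normr_gt0// mul1r.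
Qed.

Lemma logsin_node_integrable eta tau : 0 < eta ->
  mu.-integrable `[0, 1] (EFin \o (fun p => logsin (node eta p - tau))).
Proof.
move=> e0; have [t0|t0] := eqVneq (sin (pi * tau)) 0; last first.
  by have [] := logsin_node_integral e0 t0.
have u0 : sinh eta * cos (pi * tau) != 0.
  apply: mulf_neq0; first by rewrite gt_eqF// sinh_gt0.
  by rewrite -normr_gt0 (sin0cos1 t0).
pose c := 2 * ln 2 + ln `|sinh eta * cos (pi * tau)|.
have := @integrableB _ _ _ mu `[0, 1]%classic _ _ _ (@cst_integrable R c 0 1)
  (weight_integrable e0).
move=> /(_ (measurable_itv _)); apply: eq_integrable => // p _ /=.
by rewrite logsin_node// t0 mulr0 subr0.
Qed.

End KernelIntegral.


(** * Exchange of the two integrations *)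

Section Averaging.
Context {R : realType}.
Notation mu := (@lebesgue_measure R).
Implicit Types (eta tau theta x p q c d y : R).

(** The mean over the nodes of the potential of [e^{2 pi i theta}], the nodes
    being rotated by [x]. *)
Definition node_mean eta theta x : R :=
  \int[mu]_(p in `[0, 1]) logsin (node eta p - (theta - x)).

Section Fubini.
Variables (eta theta c : R) (J : set R).
Hypotheses (e0 : 0 < eta) (mJ : measurable J) (Jc : J `<=` `[c, c + 1]).

Let K : set R := `[0, 1]%classic.
Let g (z : R * R) : R := logsin (node eta z.2 - (theta - z.1)).
(** Indicators make the domain of integration the whole plane. *)
Let f (z : R * R) : \bar R := (g z * \1_J z.1 * \1_K z.2)%:E.

Let mf : measurable_fun [set: measurableTypeR R * measurableTypeR R] f.
Proof.
apply/measurable_EFinP; apply: measurable_funM; first apply: measurable_funM.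
- apply: (measurableT_comp measurable_logsin); apply: measurable_funB.
    apply: (measurableT_comp (_ : measurable_fun [set: R] (node eta))) => //.
    by apply: continuous_measurable_fun; exact: continuous_node.
  by apply: measurable_funB => //.
- by apply: (measurableT_comp (@measurable_indic _ _ R setT J mJ)).
- by apply: (measurableT_comp (@measurable_indic _ _ R setT K (measurable_itv _))).
Qed.

Let int_x p : K p -> (\int[mu]_x f (x, p) = \int[mu]_(x in J) (g (x, p))%:E)%E.
Proof.
move=> Kp; rewrite [RHS]integral_mkcond; apply: eq_integral => x _.
rewrite /f /= patchE !indicE (mem_set Kp) mulr1.
by case: (x \in J); rewrite ?mulr1 ?mulr0.
Qed.

Let int_p x : J x -> (\int[mu]_p f (x, p) = \int[mu]_(p in K) (g (x, p))%:E)%E.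
Proof.
move=> Jx; rewrite [RHS]integral_mkcond; apply: eq_integral => p _.
rewrite /f /= patchE !indicE (mem_set Jx) mulr1.
by case: (p \in K); rewrite ?mulr1 ?mulr0.
Qed.

Let int_x0 p : ~ K p -> (\int[mu]_x f (x, p) = 0)%E.
Proof.
move=> Kp; apply: integral0_eq => x _.
by rewrite /f /= !indicE (memNset Kp) mulr0.
Qed.

Let int_p0 x : ~ J x -> (\int[mu]_p f (x, p) = 0)%E.
Proof.
move=> Jx; apply: integral0_eq => p _.
by rewrite /f /= !indicE (memNset Jx) mulr0 mul0r.
Qed.

Let gE x p : g (x, p) = logsin (x - (theta - node eta p)).
Proof. by rewrite /g /=; congr logsin; ring. Qed.

Let mG : measurable_fun [set: measurableTypeR R] (fun p => \int[mu]_x `|f (x, p)|)%E.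
Proof.
apply: (@measurable_fun_fubini_tonelli_G _ _ (measurableTypeR R) (measurableTypeR R)
  R mu (abse \o f)) => //.
  by apply: measurableT_comp.
by move=> z; exact: abse_ge0.
Qed.

Let fint : (mu \x mu)%E.-integrable [set: measurableTypeR R * measurableTypeR R] f.
Proof.
have l2 : 0 <= ln 2 :> R by rewrite ln_ge0// ler1n.
apply/(integrable21ltyP mu mu mf).
pose D : set R := `[c, c + 1]%classic.
have m1 : measurable D by exact: measurable_itv.
have bound p : K p -> (\int[mu]_x `|f (x, p)| <= (2 * ln 2)%:E)%E.
  move=> Kp; have -> : (\int[mu]_x `|f (x, p)| = \int[mu]_(x in J) `|g (x, p)|%:E)%E.
    rewrite [RHS]integral_mkcond; apply: eq_integral => x _.
    rewrite /f /= patchE !indicE (mem_set Kp) mulr1.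
    by case: (x \in J); rewrite ?mulr1 ?mulr0 ?normr0.
  have Ig : mu.-integrable D (EFin \o (fun x => g (x, p))).
    have := logsin_integrable_unit c (theta - node eta p).
    by apply: eq_integrable => // x _ /=; rewrite gE.
  have mg : measurable_fun D (fun x => `|g (x, p)|%:E).
    apply/measurable_EFinP; apply: (measurableT_comp (@normr_measurable R setT)).
    by apply/measurable_EFinP; exact: (measurable_int mu Ig).
  apply: (@le_trans _ _ (\int[mu]_(x in D) `|g (x, p)|%:E)%E).
    exact: ge0_subset_integral.
  have Ib : mu.-integrable D (EFin \o (fun x => 2 * ln 2 - g (x, p))).
    exact: (@integrableB _ _ _ mu _ m1 _ _ (@cst_integrable R _ c (c + 1)) Ig).
  have gl x : g (x, p) <= ln 2 by rewrite /g logsin_le.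
  apply: (@le_trans _ _ (\int[mu]_(x in D) (2 * ln 2 - g (x, p))%:E)%E).
    apply: ge0_le_integral => //; first exact: (measurable_int mu Ib).
    move=> x _; rewrite lee_fin ler_norml; have := gl x.
    by move: (g _) => u ul; apply/andP; split; lra.
  rewrite -(fineK (integrable_fin_num _ Ib))// lee_fin.
  rewrite -[fine _]/(Rintegral mu D (fun x => 2 * ln 2 - g (x, p))).
  rewrite RintegralB//; last exact: cst_integrable.
  under [X in _ - X]eq_Rintegral do rewrite gE.
  by rewrite /D Rintegral_logsin Rintegral_itv_cst ?lerDl// subr0 [c + 1]addrC addrK mulr1.
apply: (@le_lt_trans _ _ (\int[mu]_p ((cst (2 * ln 2)%:E) \_ K) p)%E).
  apply: ge0_le_integral => //.
  - by move=> p _; exact: integral_ge0.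
  - have [+ _] := @measurable_restrictT _ _ _ _ K (cst (2 * ln 2)%:E : R -> \bar R)
      (measurable_itv _).
    by apply; exact: measurable_cst.
  - move=> p _; rewrite patchE; case: ifPn => [|/negP]; rewrite inE => Kp; first exact: bound.
    rewrite integral0_eq// => x _.
    by rewrite /f /= !indicE (memNset Kp) mulr0 normr0.
rewrite -integral_mkcond integral_cst; last exact: measurable_itv.
by rewrite [X in (_ * X)%E](@lebesgue_measure_itv R `[0, 1])/= lte_fin ltr01 -EFinM ltry.
Qed.

Lemma node_mean_integrable : mu.-integrable J (EFin \o node_mean eta theta).
Proof.
have := integrable_fubini_F fint; rewrite /fubini_F => H.
have : mu.-integrable J (fun x => \int[mu]_p f (x, p))%E.
  by apply: integrableS H.
apply: eq_integrable => // x; rewrite inE => Jx; rewrite int_p// /= /node_mean /Rintegral.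
by rewrite fineK//; apply: integrable_fin_num => //; exact: logsin_node_integrable.
Qed.

Lemma Rintegral_node_mean : \int[mu]_(x in J) node_mean eta theta x =
  \int[mu]_(p in `[0, 1]) \int[mu]_(x in J) logsin (x - (theta - node eta p)).
Proof.
have := Fubini fint => H; rewrite /Rintegral; congr fine.
transitivity (\int[mu]_x \int[mu]_p f (x, p))%E.
  rewrite [LHS]integral_mkcond; apply: eq_integral => x _; rewrite patchE.
  case: ifPn => [|/negP]; rewrite inE => Jx; last by rewrite int_p0.
  rewrite int_p// /node_mean /Rintegral.
  by rewrite fineK//; apply: integrable_fin_num => //; exact: logsin_node_integrable.
rewrite H [RHS]integral_mkcond; apply: eq_integral => p _; rewrite patchE.
case: ifPn => [|/negP]; rewrite inE => Kp; last by rewrite int_x0.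
rewrite int_x// fineK; first by apply: eq_integral => x _; rewrite gE.
apply: integrable_fin_num => //; apply: integrableS (logsin_integrable_unit c _) => //.
Qed.

Lemma logsin_itv_integrable : mu.-integrable `[0, 1]
  (EFin \o (fun p => \int[mu]_(x in J) logsin (x - (theta - node eta p)))).
Proof.
have H : mu.-integrable [set: measurableTypeR R] (fun p => \int[mu]_x f (x, p))%E.
  apply/integrableP; split; first exact: (measurable_fubini_G fint).
  apply: le_lt_trans ((integrable21ltyP mu mu mf).1 fint).
  apply: ge0_le_integral => //.
    apply: measurableT_comp => //; exact: (measurable_fubini_G fint).
  move=> p _; apply: le_abse_integral => //.
  apply: measurableT_comp => //.
have : mu.-integrable K (fun p => \int[mu]_x f (x, p))%E.
  apply: integrableS H => //; exact: measurable_itv.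
apply: eq_integrable; first exact: measurable_itv.
move=> p; rewrite inE => Kp; rewrite int_x//= /Rintegral fineK.
  by apply: eq_integral => x _; rewrite gE.
apply: integrable_fin_num => //; apply: integrableS (logsin_integrable_unit c _) => //.
Qed.

End Fubini.
End Averaging.


(** * The kernel and the counting inequality *)

Section Majorant.
Context {R : realType}.
Notation mu := (@lebesgue_measure R).
Implicit Types (eta theta x p q a b c d y : R).

Lemma node_mean_integrable_unit eta theta a b : 0 < eta -> b <= a + 1 ->
  mu.-integrable `[a, b] (EFin \o node_mean eta theta).
Proof.
move=> e0 ba; apply: (@node_mean_integrable R eta theta a) => // x /=.
by rewrite !in_itv/= => /andP[-> /le_trans]; apply.
Qed.

Lemma logsin_integrable a b d : b <= a + 1 ->
  mu.-integrable `[a, b] (EFin \o (fun x => logsin (x - d))).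
Proof.
move=> ba; apply: integrableS (logsin_integrable_unit a d) => // x /=.
by rewrite !in_itv/= => /andP[-> /le_trans]; apply.
Qed.

(** A kernel of mass [eta] over a period, nonnegative off [theta + Z] and carried
    modulo [1] by the points at distance at most [halfwidth eta] from [theta]. *)
Definition kappa eta theta x : R := eta + node_mean eta theta x - logsin (x - theta).

Lemma kappa_integrable eta theta a b : 0 < eta -> b <= a + 1 ->
  mu.-integrable `[a, b] (EFin \o kappa eta theta).
Proof.
move=> e0 ba; have mD : measurable (`[a, b]%classic : set R) by exact: measurable_itv.
have I1 := @integrableD _ _ _ mu _ mD _ _ (@cst_integrable R eta a b)
  (node_mean_integrable_unit theta e0 ba).
exact: (@integrableB _ _ _ mu _ mD _ _ I1 (logsin_integrable theta ba)).
Qed.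

Lemma Rintegral_kappa eta theta a b : 0 < eta -> a <= b -> b <= a + 1 ->
  \int[mu]_(x in `[a, b]) kappa eta theta x = eta * (b - a) +
  \int[mu]_(x in `[a, b]) node_mean eta theta x - \int[mu]_(x in `[a, b]) logsin (x - theta).
Proof.
move=> e0 ab ba; have mD : measurable (`[a, b]%classic : set R) by exact: measurable_itv.
rewrite RintegralB//; last 2 first.
- exact: (@integrableD _ _ _ mu _ mD _ _ (@cst_integrable R eta a b)
    (node_mean_integrable_unit theta e0 ba)).
- exact: logsin_integrable.
rewrite RintegralD//; first by rewrite Rintegral_itv_cst.
- exact: cst_integrable.
- exact: node_mean_integrable_unit.
Qed.

Lemma Rintegral_kappa_unit eta theta c : 0 < eta ->
  \int[mu]_(x in `[c, c + 1]) kappa eta theta x = eta.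
Proof.
move=> e0; rewrite Rintegral_kappa ?lerDl// Rintegral_logsin subr0.
have -> : c + 1 - c = 1 by ring.
rewrite mulr1 (@Rintegral_node_mean R eta theta c)//.
rewrite (eq_Rintegral mu (g := fun=> 0)); last by move=> p _; exact: Rintegral_logsin.
by rewrite Rintegral_itv_cst ?ler01// mul0r addr0.
Qed.

Lemma node_mean_node_integral eta theta x : 0 < eta -> sin (pi * (x - theta)) != 0 ->
  logsin (x - theta) - eta <= node_mean eta theta x /\
  (`|sinh eta * cos (pi * (x - theta))| <= `|sin (pi * (x - theta))| ->
   node_mean eta theta x = logsin (x - theta) - eta).
Proof.
move=> e0; have -> : x - theta = - (theta - x) by ring.
rewrite mulrN sinN cosN oppr_eq0 logsinN normrN => s0.
by have [_ ] := logsin_node_integral e0 s0.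
Qed.

Lemma kappa_ge0 eta theta x : 0 < eta -> sin (pi * (x - theta)) != 0 -> 0 <= kappa eta theta x.
Proof.
by move=> e0 s0; have [h _] := node_mean_node_integral e0 s0; rewrite /kappa; lra.
Qed.

Lemma halfwidth_gt0 eta : 0 < eta -> 0 < halfwidth eta.
Proof.
move=> e0; rewrite divr_gt0 ?pi_gt0// -(@atan0 R); exact/lt_atan/sinh_gt0.
Qed.

(** In terms of [tau = x - theta] the condition on [x] says that
    [sinh eta * |cos (pi tau)| <= sin (pi tau)]; this follows from the signs of
    [sin (pi tau - a)] and [sin (pi tau + a)] with [a = atan (sinh eta)]. *)
Lemma kappa_eq0 eta theta x : 0 < eta ->
  halfwidth eta <= x - theta <= 1 - halfwidth eta -> kappa eta theta x = 0.
Proof.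
move=> e0 /andP[]; set tau := x - theta => t1 t2.
have d0 := halfwidth_gt0 e0.
have p0 := pi_gt0 R.
have st : 0 < sin (pi * tau).
  by apply: sin_gt0_pi; rewrite pmulr_rgt0// gtr_pMr//; apply/andP; split; lra.
have aE : pi * halfwidth eta = atan (sinh eta).
  by rewrite /halfwidth mulrC divfK// gt_eqF.
set a := atan (sinh eta) in aE.
have ca : 0 < cos a by rewrite cos_gt0_pihalf// atan_gtNpi2 atan_ltpi2.
have sa : sin a = sinh eta * cos a.
  have <- : tan a = sinh eta by rewrite atanK.
  by rewrite /tan divfK// gt_eqF.
have h1 : 0 <= sin (pi * tau - a).
  by apply: sin_ge0_pi; rewrite -aE -mulrBr; apply/andP; split; nra.
have h2 : 0 <= sin (pi * tau + a).
  by apply: sin_ge0_pi; rewrite -aE -mulrDr; apply/andP; split; nra.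
have [_ ] := @node_mean_node_integral eta theta x e0 (lt0r_neq0 st).
rewrite -/tau /kappa => ->; first by rewrite -/tau; ring.
rewrite (gtr0_norm st) ler_norml; move: h1 h2; rewrite sinB sinD sa => h1 h2.
by apply/andP; split; nra.
Qed.

Lemma kappa_integral_ge eta theta a b : 0 < eta ->
  a + halfwidth eta <= theta <= b - halfwidth eta -> a <= b -> b <= a + 1 ->
  eta <= \int[mu]_(x in `[a, b]) kappa eta theta x.
Proof.
move=> e0 /andP[t1 t2] ab ba; rewrite -{1}(Rintegral_kappa_unit theta a e0).
rewrite (Rintegral_itv_cat ab ba (kappa_integrable theta e0 (lexx _))).
rewrite -[X in _ <= X]addr0 lerD2l.
under eq_Rintegral => x.
  rewrite inE/= in_itv/= => /andP[x1 x2]; rewrite kappa_eq0//; last first.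
    by apply/andP; split; lra.
  over.
by rewrite Rintegral_cst// mul0r.
Qed.

Lemma kappa_integral_ge0 eta theta a b : 0 < eta -> b <= a + 1 ->
  0 <= \int[mu]_(x in `[a, b]) kappa eta theta x.
Proof.
move=> e0 ba; apply: (Rintegral_ge0_off _ (countable_sinpi0 theta)) => //.
- exact: kappa_integrable.
- by move=> x _ /= /eqP; exact: kappa_ge0.
Qed.

Section Core.
Variables (thetas : seq R) (H : R -> R).
Hypotheses (cH : continuous H) (pH : periodic1 H) (H0 : forall t, 0 <= H t).
Hypothesis HU : forall t, (forall theta, theta \in thetas -> sin (pi * (t - theta)) != 0) ->
  \sum_(theta <- thetas) logsin (t - theta) <= H t.

Let h := \int[mu]_(x in `[0, 1]) H x.

(** The potential of all the points [e^{2 pi i theta}], rotated by [d]. *)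
Let U d x := \sum_(theta <- thetas) logsin (x - (theta - d)).
Let N d := \bigcup_(theta in [set` thetas]) [set x | sin (pi * (x - (theta - d))) = 0].

Let cN d : countable (N d).
Proof.
apply: bigcup_countable => [|theta _]; last exact: countable_sinpi0.
exact/finite_set_countable/finite_seq.
Qed.

Let UH d x : ~ N d x -> U d x <= H (x + d).
Proof.
move=> Nx; have E theta : x - (theta - d) = x + d - theta by ring.
apply: le_trans (HU _); first by rewrite /U; under eq_bigr do rewrite E.
move=> theta tin; apply/eqP => s0; apply: Nx; exists theta => //=.
by rewrite E.
Qed.

Let cHd d : continuous (fun x => H (x + d)).
Proof.
move=> x; apply: (@continuous_comp _ _ _ (fun x => x + d) H); last exact: cH.
by apply: cvgD; [exact: cvg_id|exact: cvg_cst].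
Qed.

Let U_int d a b : b <= a + 1 -> mu.-integrable `[a, b] (EFin \o U d) /\
  \int[mu]_(x in `[a, b]) U d x =
  \sum_(theta <- thetas) \int[mu]_(x in `[a, b]) logsin (x - (theta - d)).
Proof. by move=> ba; apply: Rintegral_sum => // theta; exact: logsin_integrable. Qed.

Let H_unit d c : \int[mu]_(x in `[c, c + 1]) H (x + d) = h.
Proof. exact: Rintegral_period_shift. Qed.

Let U_le d a b : a <= b -> b <= a + 1 -> \int[mu]_(x in `[a, b]) U d x <= h.
Proof.
move=> ab ba; have [IU _] := U_int d ba.
apply: (@le_trans _ _ (\int[mu]_(x in `[a, b]) H (x + d))).
  apply: (le_Rintegral_off _ (cN d)) => //; last by move=> x _; exact: UH.
  exact: continuous_itv_integrable.
rewrite -(H_unit d a).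
apply: (@Rintegral_subitv_le _ set0) => //.
exact: continuous_itv_integrable.
Qed.

Let U_ge a b : a <= b -> b <= a + 1 -> - h <= \int[mu]_(x in `[a, b]) U 0 x.
Proof.
move=> ab ba; have [IU _] := U_int 0 ba; have [IU1 EU1] := U_int 0 (lexx (a + 1)).
have IH c d := continuous_itv_integrable c d (@cHd 0).
have : \int[mu]_(x in `[a, b]) (H (x + 0) - U 0 x) <=
       \int[mu]_(x in `[a, a + 1]) (H (x + 0) - U 0 x).
  apply: (Rintegral_subitv_le (cN 0)) => //.
    exact: (@integrableB _ _ _ mu _ (measurable_itv _) _ _ (IH a (a + 1)) IU1).
  by move=> x _ /UH; rewrite subr_ge0.
rewrite !RintegralB// H_unit EU1 big1; last by move=> theta _; exact: Rintegral_logsin.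
have Hpos : 0 <= \int[mu]_(x in `[a, b]) H (x + 0) by apply: Rintegral_ge0.
by rewrite subr0 lerBlDr => /(le_trans Hpos); rewrite addrC -lerBlDr sub0r.
Qed.

(** Integrating the kernels over the interval enlarged by [halfwidth eta] on both
    sides counts each point of [[a, b]] at least [eta] times; the same integral is
    [eta] times the expected number plus a difference of two integrals of the total
    potential over intervals of length at most [1], each controlled by [h]. *)
Lemma count_le eta a b : 0 < eta -> a <= b -> b - a + 2 * halfwidth eta <= 1 ->
  (count (fun theta => a <= theta <= b) thetas)%:R <=
  (size thetas)%:R * (b - a + 2 * halfwidth eta) + 2 * h / eta.
Proof.
move=> e0 ab; have := halfwidth_gt0 e0.
have dlE : halfwidth eta = halfwidth eta by [].
move: {-1}(halfwidth eta) dlE => dl dlE d0 w1.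
have ab' : a - dl <= b + dl by lra.
have ba' : b + dl <= a - dl + 1 by lra.
have wE : b + dl - (a - dl) = b - a + 2 * dl by ring.
have step1 : eta * (count (fun theta => a <= theta <= b) thetas)%:R <=
    \sum_(theta <- thetas) \int[mu]_(x in `[a - dl, b + dl]) kappa eta theta x.
  elim: thetas => [|theta s IH]; first by rewrite big_nil mulr0.
  rewrite big_cons /= natrD mulrDr lerD//.
  case: (boolP (a <= theta <= b)) => tab; last by rewrite mulr0 kappa_integral_ge0.
  by rewrite mulr1 kappa_integral_ge// dlE addrNK addrK.
have step2 : \sum_(theta <- thetas) \int[mu]_(x in `[a - dl, b + dl]) kappa eta theta x =
    (size thetas)%:R * (eta * (b - a + 2 * dl)) +
    \sum_(theta <- thetas) \int[mu]_(x in `[a - dl, b + dl]) node_mean eta theta x -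
    \int[mu]_(x in `[a - dl, b + dl]) U 0 x.
  have [_ ->] := U_int 0 ba'.
  under eq_bigr do rewrite Rintegral_kappa// wE.
  rewrite !big_split/= sumrN; congr (_ + _ - _).
    rewrite big_const_seq count_predT iter_addr_0 [RHS]mulr_natl. exact: erefl.
  by apply: eq_bigr => theta _; rewrite subr0.
have sub : `[a - dl, b + dl] `<=` `[a - dl, a - dl + 1].
  by move=> x /=; rewrite !in_itv/= => /andP[-> /le_trans]; apply.
have step3 : \sum_(theta <- thetas) \int[mu]_(x in `[a - dl, b + dl]) node_mean eta theta x <= h.
  under eq_bigr do rewrite (Rintegral_node_mean _ e0 _ sub)//.
  have [IS <-] := @Rintegral_sum R R thetas `[0, 1]%classic
    (fun theta p => \int[mu]_(x in `[a - dl, b + dl]) logsin (x - (theta - node eta p)))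
    (measurable_itv _) (fun theta => logsin_itv_integrable theta e0 (measurable_itv _) sub).
  rewrite -[X in _ <= X]mulr1 -[X in h * X](subr0 1) -Rintegral_itv_cst ?ler01//.
  apply: le_Rintegral => //; first exact: cst_integrable.
  by move=> p _; have [_ <-] := U_int (node eta p) ba'; exact: U_le.
have step4 := U_ge ab' ba'.
have step5 : eta * (count (fun theta => a <= theta <= b) thetas)%:R <=
    (size thetas)%:R * (eta * (b - a + 2 * dl)) + 2 * h.
  apply: (le_trans step1); rewrite step2.
  move: step3 step4; move: (\sum_(theta <- thetas) _) (h) => S h'.
  by move: (Rintegral _ _ _) => I S3 S4; lra.
rewrite -(ler_pM2l e0); apply: le_trans step5 _.
rewrite le_eqVlt; apply/orP; left; apply/eqP; field.
by rewrite gt_eqF.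
Qed.

End Core.

End Majorant.


(** * Polar form and moduli *)

Local Open Scope complex_scope.

Section Polynomial.
Context {R : realType}.
Implicit Types (eta x a b t : R) (z w : R[i]) (P : {poly R[i]}).

Lemma atan_sinh_le eta : 0 <= eta -> atan (sinh eta) <= eta.
Proof.
move=> e0; rewrite -subr_ge0.
pose f x : R := x - atan (sinh x).
have df x : is_derive x 1 f (1 - (1 + sinh x ^+ 2)^-1 * ((expR x + expR (- x)) / 2)).
  have dN : is_derive x 1 (fun x => expR (- x)) (expR (- x) * -1).
    exact: (@is_derive1_comp R expR (fun x => - x)).
  have ds : is_derive x 1 (@sinh R) ((expR x + expR (- x)) / 2).
    by apply: is_derive_eq; rewrite !scaler0 add0r mulrN1 opprK [RHS]mulrC.
  exact: (is_deriveB _ (@is_derive1_comp R atan sinh x _ _ _ ds)).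
have f0 : f 0 = 0 by rewrite /f /sinh oppr0 subrr mul0r atan0 subrr.
rewrite -/(f eta) -f0.
apply: (@ger0_derive1_ndecry R f 0) => //.
- move=> x _; rewrite derive1E derive_val subr_ge0.
  have := expRxMexpNx_1 x; have := sum_expR_ge2 x; rewrite /sinh.
  move: (expR x) (expR (- x)) => u v uv2 uv1.
  have -> : 1 + ((u - v) / 2) ^+ 2 = ((u + v) / 2) ^+ 2 by field: uv1.
  have p : 1 <= (u + v) / 2 by lra.
  have p0 : 0 < (u + v) / 2 by lra.
  by rewrite expr2 invfM mulfVK ?gt_eqF// invf_le1.
- apply: continuous_subspaceT => x.
  by apply: differentiable_continuous; apply/derivable1_diffP.
Qed.

Lemma halfwidth_le eta : 0 <= eta -> halfwidth eta <= eta / pi.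
Proof. by move=> e0; rewrite ler_pM2r ?invr_gt0 ?pi_gt0// atan_sinh_le. Qed.

Lemma expi2pi_int t (k : int) : expi2pi (t + k%:~R) = expi2pi t.
Proof.
rewrite /expi2pi (periodic1_int (@cos2pi_periodic R)).
by rewrite (periodic1_int (@sin2pi_periodic R)).
Qed.

(** For [z = 0] every [t] is suitable. *)
Lemma polar_exists z : exists t, z = (cmod z)%:C * expi2pi t.
Proof.
have [->|z0] := eqVneq z 0; first by exists 0; rewrite /cmod Normc.normc0 mul0r.
have r0 : cmod z != 0 by apply: contra_neq z0; exact: Normc.eq0_normc.
case: z z0 r0 => x y _; set r := cmod _ => r0.
have r2 : x ^+ 2 + y ^+ 2 = r ^+ 2.
  by rewrite /r /cmod /= sqr_sqrtr// addr_ge0// sqr_ge0.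
have rp : 0 < r by rewrite lt0r r0 sqrtr_ge0.
have xr : `|x / r| <= 1.
  rewrite normf_div (gtr0_norm rp) ler_pdivrMr// mul1r -(gtr0_norm rp).
  by rewrite -ler_sqr ?nnegrE// !real_normK ?num_real// -r2 lerDl sqr_ge0.
have [q qx] := cos2pi_surj xr.
have /eqP : sin (2 * pi * q) ^+ 2 = (y / r) ^+ 2.
  rewrite sin2cos2 qx !expr_div_n -r2; field.
  by rewrite r2 expf_neq0.
have E t : cos (2 * pi * t) = x / r -> sin (2 * pi * t) = y / r ->
    x +i* y = r%:C * expi2pi t.
  move=> ct st; rewrite /expi2pi ct st; simpc.
  by rewrite ![r * _]mulrC !divfK.
rewrite eqf_sqr => /orP[] /eqP sq; first by exists q; apply: E.
by exists (- q); apply: E; rewrite mulrN ?cosN ?sinN// sq opprK.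
Qed.

Lemma polar_exists_itv z a : exists2 t, a <= t < a + 1 & z = (cmod z)%:C * expi2pi t.
Proof.
have [t zt] := polar_exists z.
exists (t + (- Num.floor (t - a))%:~R); last by rewrite expi2pi_int.
have := floor_itv (t - a); rewrite intrD mulrNz => /andP[h1 h2].
by apply/andP; split; lra.
Qed.

Lemma cmodM z w : cmod (z * w) = cmod z * cmod w.
Proof. exact: Normc.normcM. Qed.

Lemma cmodN z : cmod (- z) = cmod z.
Proof. by case: z => x y; rewrite /cmod /= !sqrrN. Qed.

Lemma cmod_prod (s : seq R[i]) (F : R[i] -> R[i]) :
  cmod (\prod_(z <- s) F z) = \prod_(z <- s) cmod (F z).
Proof.
elim: s => [|z s IH]; first by rewrite !big_nil; exact: Normc.normc1.
by rewrite !big_cons cmodM IH.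
Qed.

Lemma cmod_ge0 z : 0 <= cmod z.
Proof. by case: z => x y; exact: sqrtr_ge0. Qed.

Lemma cmod_gt0 z : z != 0 -> 0 < cmod z.
Proof.
by move=> z0; rewrite lt0r cmod_ge0 andbT; apply: contra_neq z0; exact: Normc.eq0_normc.
Qed.

Lemma cmod_expi_sub t r theta :
  cmod (expi2pi t - r%:C * expi2pi theta) ^+ 2 =
  1 + r ^+ 2 - 2 * r * cos (2 * pi * (t - theta)).
Proof.
rewrite /expi2pi; simpc; rewrite /cmod/= sqr_sqrtr ?addr_ge0 ?sqr_ge0//.
rewrite mulrBr cosB.
have := cos2Dsin2 (2 * pi * t); have := cos2Dsin2 (2 * pi * theta).
move: (cos (2 * pi * t)) (sin (2 * pi * t)) (cos (2 * pi * theta)) => c1 s1 c2.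
move: (sin (2 * pi * theta)) => s2 h1 h2.
transitivity (c1 ^+ 2 + s1 ^+ 2 + r ^+ 2 * (c2 ^+ 2 + s2 ^+ 2)
  - 2 * r * (c1 * c2 + s1 * s2)); first by ring.
by rewrite h1 h2; ring.
Qed.

(** Moving a zero radially to the unit circle does not increase the normalised
    modulus, since [(1 - r) ^ 2 >= 0]. *)
Lemma sine_le_cmod t z theta : z != 0 -> z = (cmod z)%:C * expi2pi theta ->
  `|2 * sin (pi * (t - theta))| <= cmod (expi2pi t - z) / Num.sqrt (cmod z).
Proof.
move=> z0 zE; have r0 := cmod_gt0 z0.
rewrite -ler_sqr ?nnegrE ?divr_ge0 ?cmod_ge0 ?sqrtr_ge0//.
rewrite real_normK ?num_real// expr_div_n sqr_sqrtr ?(ltW r0)// -one_sub_cos2pi.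
rewrite ler_pdivlMr// {2}zE cmod_expi_sub -subr_ge0.
move: (cmod z) (cos _) => r c.
have -> : 1 + r ^+ 2 - 2 * r * c - (2 - 2 * c) * r = (1 - r) ^+ 2 by ring.
exact: sqr_ge0.
Qed.

Lemma logplusE x : logplus x = ln (Num.max x 1).
Proof.
rewrite /logplus; have [x1|x1] := leP x 1.
  by rewrite ln1; apply/max_idPr; exact: ln_le0.
by apply/max_idPl; rewrite ln_ge0// ltW.
Qed.

Lemma continuous_logplus : continuous (@logplus R).
Proof.
have -> : @logplus R = fun x => ln ((x + 1 + `|x - 1|) / 2).
  by apply/funext => x; rewrite logplusE maxr_absE.
move=> x; apply: (@continuous_comp _ _ _ (fun x => (x + 1 + `|x - 1|) / 2) (@ln R)).
  apply: cvgM; last exact: cvg_cst.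
  apply: cvgD; first by apply: cvgD; [exact: cvg_id|exact: cvg_cst].
  by apply: cvg_norm; apply: cvgB; [exact: cvg_id|exact: cvg_cst].
by apply: continuous_ln; rewrite -maxr_absE lt_max ltr01 orbT.
Qed.

Lemma continuous_cmod_expi z : continuous (fun t => cmod (expi2pi t - z)).
Proof.
case: z => x y t; rewrite /expi2pi /cmod/=.
pose f t := (cos (2 * pi * t) - x) ^+ 2 + (sin (2 * pi * t) - y) ^+ 2.
apply: (@continuous_comp _ _ _ f (@Num.sqrt R)); last exact: sqrt_continuous.
apply: cvgD; apply: cvgM; (apply: cvgB; last exact: cvg_cst);
  try exact: continuous_cos2pi.
all: apply: (@continuous_comp _ _ _ (fun t => 2 * pi * t) (@sin R)).
all: try exact: continuous_sin.
all: by apply: cvgM; [exact: cvg_cst|exact: cvg_id].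
Qed.

End Polynomial.


(** * From the counting inequality to the discrepancy *)

Section Discrepancy.
Context {R : realType}.
Implicit Types (eta x a b t : R) (z w : R[i]).
Variables (P : {poly R[i]}).
Hypotheses (hmonic : P \is monic) (hP0 : P.[0] != 0).

Lemma zerosE : P = \prod_(z <- zeros P) ('X - z%:P).
Proof.
have := svalP (closed_field_poly_normal P).
by rewrite -/(zeros P) (monicP hmonic) scale1r.
Qed.

Lemma size_zeros : size (zeros P) = (size P).-1.
Proof. by rewrite [in RHS]zerosE size_prod_XsubC. Qed.

Lemma zeros_neq0 z : z \in zeros P -> z != 0.
Proof.
move=> zP; apply: contraNneq hP0 => z0; rewrite zerosE horner_prod.
by rewrite (big_rem z)//= hornerXsubC z0 subrr mul0r.
Qed.

(** The integrand in the definition of [height P]. *)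
Definition height_integrand t : R :=
  logplus (cmod P.[expi2pi t] / Num.sqrt (cmod P.[0])).

Lemma cmod_hornerE w : cmod P.[w] = \prod_(z <- zeros P) cmod (w - z).
Proof.
rewrite [in LHS]zerosE horner_prod cmod_prod.
by apply: eq_bigr => z _; rewrite hornerXsubC.
Qed.

Lemma height_integrand_periodic : periodic1 height_integrand.
Proof. by move=> t; rewrite /height_integrand (expi2pi_int t 1). Qed.

Lemma height_integrand_ge0 t : 0 <= height_integrand t.
Proof. by rewrite /height_integrand /logplus le_max lexx orbT. Qed.

Lemma continuous_prod_cmod (s : seq R[i]) :
  continuous (fun t => \prod_(z <- s) cmod (expi2pi t - z)).
Proof.
elim: s => [|z s IH].
  by under eq_fun do rewrite big_nil; move=> t; exact: cvg_cst.
under eq_fun do rewrite big_cons.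
by move=> t; apply: cvgM; [exact: continuous_cmod_expi|exact: IH].
Qed.

Lemma continuous_height_integrand : continuous height_integrand.
Proof.
move=> t; rewrite /height_integrand.
apply: (@continuous_comp _ _ _ (fun t => cmod P.[expi2pi t] / Num.sqrt (cmod P.[0]))
  (@logplus R)); last exact: continuous_logplus.
apply: cvgM; last exact: cvg_cst.
have -> : (fun t => cmod P.[expi2pi t]) =
    (fun t => \prod_(z <- zeros P) cmod (expi2pi t - z)).
  by apply/funext => u; rewrite cmod_hornerE.
by rewrite cmod_hornerE; exact: continuous_prod_cmod.
Qed.

(** The positive part of the normalised [ln |P|] dominates the potential of the
    zeros projected radially to the unit circle. *)
Lemma sum_logsin_le_height (theta : R[i] -> R) t :
  (forall z, z = (cmod z)%:C * expi2pi (theta z)) ->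
  (forall x, x \in map theta (zeros P) -> sin (pi * (t - x)) != 0) ->
  \sum_(x <- map theta (zeros P)) logsin (t - x) <= height_integrand t.
Proof.
move=> thE sn0; rewrite /height_integrand /logplus le_max; apply/orP; left.
have -> : cmod P.[expi2pi t] / Num.sqrt (cmod P.[0]) =
    \prod_(z <- zeros P) (cmod (expi2pi t - z) / Num.sqrt (cmod z)).
  rewrite !cmod_hornerE.
  elim: (zeros P) => [|z s IH]; first by rewrite !big_nil sqrtr1 divr1.
  rewrite !big_cons -IH sub0r cmodN sqrtrM ?cmod_ge0// invfM.
  by rewrite mulrACA.
rewrite big_map; move: sn0 zeros_neq0; elim: (zeros P) => [|z s IH] sn0 nz.
  by rewrite !big_nil ln1.
have pos w : w \in z :: s -> 0 < cmod (expi2pi t - w) / Num.sqrt (cmod w) /\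
    logsin (t - theta w) <= ln (cmod (expi2pi t - w) / Num.sqrt (cmod w)).
  move=> ws; have := sine_le_cmod t (nz w ws) (thE w).
  have s0 : 0 < `|2 * sin (pi * (t - theta w))|.
    by rewrite normr_gt0 mulf_neq0 ?pnatr_eq0// sn0// map_f.
  move=> h; have p0 := lt_le_trans s0 h.
  by split=> //; rewrite /logsin ler_ln ?posrE.
rewrite !big_cons lnM ?posrE.
- apply: lerD; first by have [] := pos z (mem_head _ _).
  apply: IH => [x xs|w ws]; first by apply: sn0; rewrite /= inE xs orbT.
  by apply: nz; rewrite inE ws orbT.
- by have [] := pos z (mem_head _ _).
- rewrite big_seq; apply: prodr_gt0 => w ws.
  by have [] := pos w (@mem_behead _ (z :: s) w ws).
Qed.

(** Arguments of all complex numbers, taken in [J] whenever that is possible. *)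
Lemma arg_choice (J : set R) : exists theta : R[i] -> R,
  forall z, z = (cmod z)%:C * expi2pi (theta z) /\ (arg_in J z -> J (theta z)).
Proof.
suff /choice [f Hf] : forall z, exists t, z = (cmod z)%:C * expi2pi t /\ (arg_in J z -> J t).
  by exists f.
move=> z; have [[t Jt zt]|nJ] := pselect (arg_in J z); first by exists t.
by have [t zt] := polar_exists z; exists t.
Qed.

Let N : R := (size P).-1%:R.

Lemma zero_count_le eta a b : 0 < eta -> a <= b ->
  (zero_count `[a, b] P)%:R <= N * (b - a) + (2 * N * eta / pi + 2 * height P / eta).
Proof.
move=> e0 ab; have hw := halfwidth_le (ltW e0).
have N0 : 0 <= N by exact: ler0n.
have h0 : 0 <= height P.
  by apply: Rintegral_ge0 => t _; exact: height_integrand_ge0.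
have hN : N * halfwidth eta <= N * (eta / pi) by rewrite ler_wpM2l.
have he : 0 <= 2 * height P / eta by rewrite divr_ge0 ?mulr_ge0// ltW.
have eE : 2 * N * eta / pi = 2 * (N * (eta / pi)) by rewrite !mulrA.
have [w1|w1] := leP (b - a + 2 * halfwidth eta) 1; last first.
  apply: (@le_trans _ _ N); first by rewrite ler_nat -size_zeros count_size.
  apply: (@le_trans _ _ (N * (b - a + 2 * halfwidth eta))).
    by rewrite ler_peMr// ltW.
  by rewrite eE mulrDr mulrCA; lra.
have [theta thE] := arg_choice `[a, b]%classic.
have core := @count_le R (map theta (zeros P)) height_integrand
  continuous_height_integrand height_integrand_periodic height_integrand_ge0
  (fun t => @sum_logsin_le_height theta t (fun z => (thE z).1)) eta a b e0 ab w1.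
rewrite size_map size_zeros -/N count_map in core.
apply: (@le_trans _ _ (count (preim theta (fun x => a <= x <= b)) (zeros P))%:R).
  rewrite ler_nat; apply: sub_count => z /asboolP /(thE z).2 /=.
  by rewrite in_itv.
apply: (le_trans core); rewrite eE -/(height P) mulrDr mulrCA.
move: (2 * _ / _) he => q q0; lra.
Qed.

Let E : R := 4 / Num.sqrt pi * Num.sqrt (N * height P).

Lemma height_ge0 : 0 <= height P.
Proof. by apply: Rintegral_ge0 => t _; exact: height_integrand_ge0. Qed.

(** The two error terms of [zero_count_le] balance at
    [eta = sqrt (pi * height P / N)]; when the height vanishes, [eta] tends to [0]. *)
Lemma zero_count_upper a b : (1 < size P)%N -> a <= b ->
  (zero_count `[a, b] P)%:R <= N * (b - a) + E.
Proof.
move=> sP ab; have N0 : 0 < N by rewrite ltr0n -subn1 subn_gt0.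
have pi0 := pi_gt0 R.
rewrite -lerBlDl.
have opt eta : 0 < eta -> (zero_count `[a, b] P)%:R - N * (b - a) <=
    2 * N * eta / pi + 2 * height P / eta.
  by move=> e0; rewrite lerBlDl zero_count_le.
move: opt; set X := _ - _ => opt.
have := height_ge0; rewrite le_eqVlt => /predU1P[h0|h0].
  rewrite /E -h0 mulr0 sqrtr0 mulr0; apply/ler_addgt0Pr => e e0; rewrite add0r.
  have e1 : 0 < e * pi / (2 * N) by rewrite divr_gt0 ?mulr_gt0.
  apply: le_trans (opt _ e1) _; rewrite -h0 mulr0 mul0r addr0.
  rewrite le_eqVlt; apply/orP; left; apply/eqP.
  by move: (pi : R) (lt0r_neq0 pi0) (lt0r_neq0 N0) => p p0 n0; field; rewrite p0.
rewrite /E; set s := Num.sqrt pi; set r := Num.sqrt (N * height P).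
have s0 : 0 < s by rewrite sqrtr_gt0.
have r0 : 0 < r by rewrite sqrtr_gt0 mulr_gt0.
have ss : pi = s ^+ 2 by rewrite sqr_sqrtr// ltW.
have rr : N * height P = r ^+ 2 by rewrite sqr_sqrtr// mulr_ge0 ?ltW.
apply: le_trans (opt (s * r / N) _) _; first by rewrite divr_gt0 ?mulr_gt0.
rewrite le_eqVlt; apply/orP; left; apply/eqP; rewrite ss.
have -> : height P = r ^+ 2 / N by rewrite -rr [N * _]mulrC mulfK// gt_eqF.
move: (N) s r N0 s0 r0 {opt ss rr X} => n s r N0 s0 r0.
by field; rewrite !gt_eqF.
Qed.

(** The lower bound for an interval is the upper bound for its complement, here
    enlarged to the closed interval [[b, a + 1]]. *)
Lemma deviation_le a b (ca cb : bool) : (1 < size P)%N -> a <= b <= a + 1 ->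
  `|(zero_count [set` Interval (BSide ca a) (BSide cb b)] P)%:R - (b - a) * N| <= E.
Proof.
move=> sP /andP[ab ba].
have subI : [set` Interval (BSide ca a) (BSide cb b)] `<=` `[a, b].
  move=> t /=; case: ca; case: cb; rewrite !in_itv/= => /andP[h1 h2];
  by rewrite ?(ltW h1) ?(ltW h2) ?h1 ?h2.
have supI : `]a, b[ `<=` [set` Interval (BSide ca a) (BSide cb b)].
  move=> t /=; case: ca subI; case: cb => _; rewrite !in_itv/= => /andP[h1 h2];
  by rewrite ?(ltW h1) ?(ltW h2) ?h1 ?h2.
move: [set` Interval (BSide ca a) (BSide cb b)] subI supI => I subI supI.
have up : (zero_count I P)%:R <= N * (b - a) + E.
  apply: le_trans (zero_count_upper sP ab); rewrite ler_nat.
  by apply: sub_count => z /asboolP [t /subI It zt]; apply/asboolP; exists t.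
have lo : N <= (zero_count I P)%:R + (zero_count `[b, a + 1] P)%:R.
  rewrite -natrD ler_nat -size_zeros -(count_predT (zeros P)).
  rewrite /zero_count -count_predUI; apply: leq_trans (leq_addr _ _).
  apply: sub_count => z _; apply/orP.
  have [t /andP[at1 ta] zt] := polar_exists_itv z a.
  have [tab|tab] := boolP (a < t < b).
    by left; apply/asboolP; exists t => //; apply: supI; rewrite /= in_itv.
  right; apply/asboolP; have [bt|tb] := leP b t.
    by exists t => //=; rewrite in_itv/= bt ltW.
  exists (t + 1); last by rewrite (expi2pi_int t 1).
  move: tab; rewrite tb andbT -leNgt => ta1 /=.
  have tE : t = a by apply/eqP; rewrite eq_le ta1.
  by rewrite in_itv/= tE ba lexx.
have up2 := zero_count_upper sP ba.
rewrite ler_norml; apply/andP; split; nra.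
Qed.

End Discrepancy.

Local Close Scope complex_scope.

Theorem theorem1 (R : realType) (N : nat) (P : {poly R[i]})
    (hN : (1 <= N)%N) (hmonic : P \is monic) (hdeg : size P = N.+1)
    (hP0 : P.[0] != 0) :
  discrepancy P <= 4 / Num.sqrt pi * Num.sqrt (N%:R * height P).
Proof.
have [x0 _] := has_sup_deviations P.
apply: ge_sup => // _ [a [b [ca [cb [ab ->]]]]].
have -> : N = (size P).-1 by rewrite hdeg.
by apply: deviation_le => //; rewrite hdeg ltnS.
Qed.
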